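(* The unimodal spi-logic $\mathsf{SPi}_{lin}=\mathsf{SPi}+\{p\to\Diamond p,\ \Diamond\Diamond p\to\Diamond p,\ \Diamond(p\wedge q)\wedge\Diamond(p\wedge r)\to\Diamond(p\wedge\Diamond q\wedge\Diamond r)\}$ is decidable in polynomial time.
   Context: Unimodal setting: one diamond $\Diamond$. Sp-formulas: built from propositional variables and $\top$ by $\wedge$ and $\Diamond$; sp-implications $\sigma\to\tau$. A SLO is an algebra $(A,\wedge,\top,\Diamond)$ with $(A,\wedge,\top)$ a meet-semilattice with top and $\Diamond$ monotone; it validates $\sigma\to\tau$ if $\sigma[\mathfrak a]\le\tau[\mathfrak a]$ for all valuations. $\mathsf{SPi}+\Sigma$ is the set of sp-implications valid in every SLO validating $\Sigma$; decidability refers to deciding membership of a given sp-implication. *)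

(* Defs.v *)
From mathcomp Require Import all_boot.
From Stdlib Require Import BinNat BinPos.
Set Implicit Arguments. Unset Strict Implicit. Unset Printing Implicit Defensive.

Inductive spf : Type :=
| Var (n : nat)
| Top
| And (a b : spf)
| Dia (a : spf).

Record spi : Type := Imp { ante : spf; cons : spf }.

Record SLO : Type := {
  car : Type;
  meet : car -> car -> car;
  top : car;
  dia : car -> car;
  meetA : forall x y z, meet x (meet y z) = meet (meet x y) z;
  meetC : forall x y, meet x y = meet y x;
  meetxx : forall x, meet x x = x;
  meetxT : forall x, meet x top = x;
  (* monotonicity w.r.t. the semilattice order x <= y :<-> meet x y = x *)
  dia_mono : forall x y, meet x y = x -> meet (dia x) (dia y) = dia x
}.

Definition sle (A : SLO) (x y : car A) : Prop := meet x y = x.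

Fixpoint eval (A : SLO) (v : nat -> car A) (f : spf) : car A :=
  match f with
  | Var n => v n
  | Top => top A
  | And a b => meet (eval v a) (eval v b)
  | Dia a => dia (eval v a)
  end.

Definition valid (A : SLO) (i : spi) : Prop :=
  forall v : nat -> car A, sle (eval v (ante i)) (eval v (cons i)).

Definition SPi_plus (Sigma : spi -> Prop) (i : spi) : Prop :=
  forall A : SLO, (forall s, Sigma s -> valid A s) -> valid A i.

Definition p := Var 0.
Definition q := Var 1.
Definition r := Var 2.

Definition Sigma_lin (s : spi) : Prop :=
  s = Imp p (Dia p) \/
  s = Imp (Dia (Dia p)) (Dia p) \/
  s = Imp (And (Dia (And p q)) (Dia (And p r)))
          (Dia (And p (And (Dia q) (Dia r)))).

Definition SPi_lin : spi -> Prop := SPi_plus Sigma_lin.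

Inductive tok : Type := TVar | TB0 | TB1 | TEnd | TTop | TAnd | TDia | TImp.

Fixpoint pos_bits (x : positive) : seq tok :=
  match x with
  | xH => [:: TB1]
  | xO y => TB0 :: pos_bits y
  | xI y => TB1 :: pos_bits y
  end.

Definition nat_bits (n : nat) : seq tok :=
  match N.of_nat n with N0 => [::] | Npos x => pos_bits x end.

Fixpoint enc_f (f : spf) : seq tok :=
  match f with
  | Var n => TVar :: nat_bits n ++ [:: TEnd]
  | Top => [:: TTop]
  | And a b => TAnd :: enc_f a ++ enc_f b
  | Dia a => TDia :: enc_f a
  end.

Definition enc (i : spi) : seq tok := TImp :: enc_f (ante i) ++ enc_f (cons i).

Inductive move : Type := MoveL | MoveR | Stay.

Record TM : Type := {
  state : finType;
  gamma : finType;
  blank : gamma;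
  inp : tok -> gamma;
  q0 : state;
  halting : pred state;
  accepting : pred state;
  delta : state -> gamma -> state * gamma * move
}.

(* configuration: state, left part of tape (reversed), scanned symbol, right part *)
Definition config (M : TM) : Type :=
  (state M * seq (gamma M) * gamma M * seq (gamma M))%type.

Definition cstate (M : TM) (c : config M) : state M :=
  let: (s, _, _, _) := c in s.

Definition step (M : TM) (c : config M) : config M :=
  let: (s, l, a, rr) := c in
  if halting s then c else
  let: (s', b, m) := delta s a in
  match m with
  | Stay => (s', l, b, rr)
  | MoveL => match l with
             | [::] => (s', [::], blank M, b :: rr)
             | x :: l' => (s', l', x, b :: rr)
             end
  | MoveR => match rr with
             | [::] => (s', b :: l, blank M, [::])
             | x :: r' => (s', b :: l, x, r')
             end
  end.

Definition init (M : TM) (w : seq tok) : config M :=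
  match map (inp M) w with
  | [::] => (q0 M, [::], blank M, [::])
  | a :: rr => (q0 M, [::], a, rr)
  end.

(* the configuration after t steps (halting states are absorbing) *)
Definition run (M : TM) (t : nat) (w : seq tok) : config M :=
  iter t (@step M) (init M w).

Definition poly_time_decidable (P : spi -> Prop) : Prop :=
  exists (M : TM) (c k : nat), forall i : spi,
    let fin := cstate (@run M (c * (size (enc i)).+1 ^ k) (enc i)) in
    halting fin /\ (accepting fin <-> P i).

(* Main.v *)
From HB Require Import structures.
Require Import Defs.
From mathcomp Require Import all_boot.
From mathcomp Require Import zify.
From Stdlib Require Import BinNat BinPos.
From Stdlib Require Import FunctionalExtensionality PropExtensionality ProofIrrelevance.
Set Implicit Arguments. Unset Strict Implicit. Unset Printing Implicit Defensive.

(** In the presence of the first two axioms, the third one says that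
    [Dia (v /\ a /\ b)] equals [Dia (v /\ a) /\ Dia (v /\ b)] for closed [a], [b]
    (those with [Dia a <= a]).  Hence a formula is the conjunction of its top-level
    variables and of the formulas [Dia (P1 /\ Dia (P2 /\ ...))] read off its
    branches, and [s -> t] is derivable iff the top-level variables of [t] occur among
    those of [s] and every branch [Q1 ... Qk] of [t] has a weakly increasing map
    [f] into a branch [P1 ... Pm] of [Dia s] with [Q_i] contained in [P_(f i)]; such a
    map is found greedily.  Conversely, an algebra whose elements are sets of such
    words refutes every implication that violates this criterion.

    The criterion speaks about boundedly many positions of the input at a time.  A
    Turing machine keeps these positions as marks on the tape cells and performs each
    elementary operation on them in one sweep over the input.  The functions of
    positions computed in this way in polynomial time are closed under iteration over
    all positions of the input, and the criterion is built from such iterations. *)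

(** * Greedy embeddings of words *)

Section GreedyEmbedding.
Variables (S T : Type) (fits : S -> T -> bool).
Implicit Types (Q : S) (P : T) (w : seq S) (u : seq T).

Definition skip_to u Q : seq T := drop (find (fits Q) u) u.

(* Consecutive letters of [w] may be sent to the same letter of [u]. *)
Definition embeds w u : bool := ~~ nilp (foldl skip_to u w).

Lemma skip_to_cons P u Q :
  skip_to (P :: u) Q = if fits Q P then P :: u else skip_to u Q.
Proof. by rewrite /skip_to /=; case: ifP. Qed.

Lemma embeds_cons Q w u : embeds (Q :: w) u = embeds w (skip_to u Q).
Proof. by []. Qed.

Lemma embeds_nil w : embeds w [::] = false.
Proof. by elim: w => // Q w; rewrite embeds_cons. Qed.

Lemma embeds_drop k w u : embeds w (drop k u) -> embeds w u.
Proof.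
elim: w k u => [|Q w IHw] k u; first by case: u => //; rewrite drop_nil.
elim: k u => [|k IHk] [|P u] //= emb; have := IHk u emb.
rewrite !embeds_cons skip_to_cons; case: ifP => // _ /IHw emb_u.
by apply: (IHw 1); rewrite drop1.
Qed.

Lemma embeds_head P P' w u : (forall Q, fits Q P -> fits Q P') ->
  embeds w (P :: u) -> embeds w (P' :: u).
Proof.
move=> fitsPP'; elim: w => // Q w IHw; rewrite !embeds_cons !skip_to_cons.
case: ifP => [/fitsPP' -> //|_]; case: ifP => // _ emb.
by apply: (embeds_drop (k := 1)); rewrite drop1; exact: embeds_drop emb.
Qed.

Lemma skip_to_filter (A : pred T) Q u :
  skip_to (filter A u) Q = filter A (drop (find (predI A (fits Q)) u) u).
Proof.
elim: u => //= P u IHu; case: ifP => AP /=; last by rewrite IHu.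
by rewrite skip_to_cons; case: ifP => //= _; rewrite AP.
Qed.

End GreedyEmbedding.

Lemma embeds_map (S S' T T' : Type) (fits : S -> T -> bool) (fits' : S' -> T' -> bool)
    (f : S' -> S) (g : T' -> T) w u :
  (forall x y, fits (f x) (g y) = fits' x y) ->
  embeds fits (map f w) (map g u) = embeds fits' w u.
Proof.
move=> eq_fits; elim: w u => [|Q w IHw] u; first by case: u.
rewrite /= !embeds_cons /skip_to find_map -map_drop IHw.
by rewrite (eq_find (a2 := fits' Q)) // => y; exact: eq_fits.
Qed.

Fixpoint vars (f : spf) : seq nat :=
  match f with
  | Var n => [:: n]
  | And a b => vars a ++ vars b
  | _ => [::]
  end.

Fixpoint branches (f : spf) : seq (seq (seq nat)) :=
  match f with
  | And a b => branches a ++ branches b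
  | Dia a => [:: vars a] :: [seq vars a :: w | w <- branches a]
  | _ => [::]
  end.

Definition sub_vars (P Q : seq nat) : bool := all [in Q] P.

Lemma sub_vars_trans P Q R : sub_vars P Q -> sub_vars Q R -> sub_vars P R.
Proof. by move=> /allP PQ /allP QR; apply/allP => n /PQ /QR. Qed.

Definition lin_criterion (i : spi) : bool :=
  sub_vars (vars (cons i)) (vars (ante i)) &&
  all (fun w => has (embeds sub_vars w) (branches (Dia (ante i)))) (branches (cons i)).

(** * Soundness *)

Section MeetSemilattice.
Variable A : SLO.
Implicit Types x y z : car A.

Lemma sle_refl x : sle x x. Proof. exact: meetxx. Qed.

Lemma sle_trans y x z : sle x y -> sle y z -> sle x z.
Proof. by rewrite /sle => xy yz; rewrite -{1}xy -meetA yz xy. Qed.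

Lemma sle_meetl x y : sle (meet x y) x.
Proof. by rewrite /sle meetC meetA meetxx. Qed.

Lemma sle_meetr x y : sle (meet x y) y.
Proof. by rewrite /sle -meetA meetxx. Qed.

Lemma sle_meet x y z : sle x y -> sle x z -> sle x (meet y z).
Proof. by rewrite /sle meetA => -> ->. Qed.

Lemma sle_top x : sle x (top A).
Proof. exact: meetxT. Qed.

Lemma sle_meet2 x x' y y' : sle x x' -> sle y y' -> sle (meet x y) (meet x' y').
Proof.
move=> xx' yy'; apply: sle_meet.
  exact: sle_trans (sle_meetl _ _) xx'.
exact: sle_trans (sle_meetr _ _) yy'.
Qed.

Definition bigmeet (I : Type) (F : I -> car A) (s : seq I) : car A :=
  \big[@meet A/top A]_(i <- s) F i.

Lemma bigmeet_cons (I : Type) (F : I -> car A) i s :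
  bigmeet F (i :: s) = meet (F i) (bigmeet F s).
Proof. exact: big_cons. Qed.

Section BigMeet.
Variables (I : eqType) (F : I -> car A).
Implicit Type s : seq I.

Lemma sle_bigmeet x s : (forall i, i \in s -> sle x (F i)) -> sle x (bigmeet F s).
Proof.
move=> xF; rewrite /bigmeet big_seq.
by apply: (big_ind (sle x)) => // [|y z]; [exact: sle_top | exact: sle_meet].
Qed.

Lemma bigmeet_sle s i : i \in s -> sle (bigmeet F s) (F i).
Proof.
elim: s => // j s IHs; rewrite inE bigmeet_cons => /predU1P[->|/IHs].
  exact: sle_meetl.
exact/sle_trans/sle_meetr.
Qed.

Lemma bigmeet_subset s t : {subset s <= t} -> sle (bigmeet F t) (bigmeet F s).
Proof. by move=> st; apply: sle_bigmeet => i /st /bigmeet_sle. Qed.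

End BigMeet.
End MeetSemilattice.

Section Soundness.
Variable A : SLO.
Hypothesis linA : forall s, Sigma_lin s -> valid A s.
Implicit Types x y z : car A.

Lemma dia_refl x : sle x (dia x).
Proof.
have ax : Sigma_lin (Imp p (Dia p)) by left.
exact: (linA ax (fun _ => x)).
Qed.

Lemma dia_trans x : sle (dia (dia x)) (dia x).
Proof.
have ax : Sigma_lin (Imp (Dia (Dia p)) (Dia p)) by right; left.
exact: (linA ax (fun _ => x)).
Qed.

Lemma dia_lin x y z :
  sle (meet (dia (meet x y)) (dia (meet x z))) (dia (meet x (meet (dia y) (dia z)))).
Proof.
have ax : Sigma_lin (Imp (And (Dia (And p q)) (Dia (And p r)))
          (Dia (And p (And (Dia q) (Dia r))))) by right; right.
exact: (linA ax (nth x [:: x; y; z])).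
Qed.

Definition closed x : Prop := sle (dia x) x.

Lemma closed_top : closed (top A). Proof. exact: sle_top. Qed.

Lemma closed_meet x y : closed x -> closed y -> closed (meet x y).
Proof.
move=> cx cy; apply: sle_meet.
  by apply: sle_trans cx; apply: dia_mono; exact: sle_meetl.
by apply: sle_trans cy; apply: dia_mono; exact: sle_meetr.
Qed.

Lemma closed_bigmeet (I : Type) (F : I -> car A) s :
  (forall i, closed (F i)) -> closed (bigmeet F s).
Proof. by move=> cF; apply: big_ind => //; [exact: closed_top | exact: closed_meet]. Qed.

Lemma dia_meet_closed x y z : closed y -> closed z ->
  sle (meet (dia (meet x y)) (dia (meet x z))) (dia (meet x (meet y z))).
Proof.
move=> cy cz; apply: sle_trans (dia_lin x y z) _; apply: dia_mono.
by apply: sle_meet2 (sle_refl x) _; exact: sle_meet2.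
Qed.

Lemma dia_bigmeet_closed (I : Type) (F : I -> car A) x s : (forall i, closed (F i)) ->
  sle (meet (dia x) (bigmeet (fun i => dia (meet x (F i))) s)) (dia (meet x (bigmeet F s))).
Proof.
move=> cF; elim: s => [|i s IHs]; first by rewrite /bigmeet !big_nil !meetxT; exact: sle_refl.
rewrite !bigmeet_cons; apply: sle_trans (dia_meet_closed x (cF i) (closed_bigmeet s cF)).
rewrite meetA [meet (dia x) _]meetC -meetA.
exact: sle_meet2 (sle_refl _) IHs.
Qed.

Variable v : nat -> car A.

Definition dia_word (w : seq (seq nat)) : car A :=
  foldr (fun P x => dia (meet (bigmeet v P) x)) (top A) w.

Lemma closed_dia_word w : closed (dia_word w).
Proof. by case: w => [|P w]; [exact: closed_top | exact: dia_trans]. Qed.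

Lemma dia_word_drop k w : sle (dia_word w) (dia_word (drop k w)).
Proof.
elim: w k => [|P w IHw] [|k] //; try exact: sle_refl.
apply: sle_trans (IHw k); apply: sle_trans (closed_dia_word w).
by apply: dia_mono; exact: sle_meetr.
Qed.

Lemma dia_word_embeds w u : embeds sub_vars w u -> sle (dia_word u) (dia_word w).
Proof.
elim: w u => [|Q w IHw] u; first by move=> _; exact: sle_top.
rewrite embeds_cons => emb.
apply: sle_trans (dia_word_drop (find (sub_vars Q) u) u) _; move: emb.
case: (boolP (has (sub_vars Q) u)) => [hasQ|noQ]; last first.
  by rewrite /skip_to hasNfind // drop_size embeds_nil.
have := nth_find [::] hasQ; rewrite has_find in hasQ.
rewrite /skip_to (drop_nth [::] hasQ).
move: (nth _ _ _) (drop _.+1 _) => P u' /allP QP /IHw emb /=.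
apply: dia_mono; apply: sle_meet.
  exact: sle_trans (sle_meetl _ _) (bigmeet_subset _ QP).
exact: sle_trans (dia_refl _) emb.
Qed.

Lemma eval_sle_vars f : sle (eval v f) (bigmeet v (vars f)).
Proof.
apply: sle_bigmeet; elim: f => [m|//|a IHa b IHb|//] n /=.
  by rewrite inE => /eqP ->; exact: sle_refl.
rewrite mem_cat => /orP[/IHa|/IHb]; apply: sle_trans.
  exact: sle_meetl.
exact: sle_meetr.
Qed.

Lemma eval_sle_branches f : sle (eval v f) (bigmeet dia_word (branches f)).
Proof.
apply: sle_bigmeet; elim: f => [m|//|a IHa b IHb|a IHa] w //=.
  rewrite mem_cat => /orP[/IHa|/IHb]; apply: sle_trans.
    exact: sle_meetl.
  exact: sle_meetr.
rewrite inE => /predU1P[->|/mapP[u /IHa au ->]] /=; apply: dia_mono.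
  by rewrite meetxT; exact: eval_sle_vars.
by apply: sle_meet au; exact: eval_sle_vars.
Qed.

Lemma normal_form_sle_eval f :
  sle (meet (bigmeet v (vars f)) (bigmeet dia_word (branches f))) (eval v f).
Proof.
elim: f => [m||a IHa b IHb|a IHa] /=.
- rewrite bigmeet_cons; exact/(sle_trans (sle_meetl _ _))/sle_meetl.
- exact: sle_top.
- by apply: sle_meet; [apply: sle_trans IHa|apply: sle_trans IHb];
    apply: sle_meet2; apply: bigmeet_subset => i; rewrite mem_cat => ->; rewrite ?orbT.
- apply: sle_trans (sle_meetr _ _) _; apply: sle_trans (dia_mono IHa).
  rewrite bigmeet_cons /= meetxT [bigmeet dia_word (map _ _)]big_map.
  exact: dia_bigmeet_closed closed_dia_word.
Qed.

Lemma lin_criterion_sle i : lin_criterion i -> sle (eval v (ante i)) (eval v (cons i)).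
Proof.
case: i => s t /andP[/allP subv /allP sube].
apply: sle_trans (normal_form_sle_eval t); apply: sle_meet.
  exact: sle_trans (eval_sle_vars s) (bigmeet_subset _ subv).
apply: sle_bigmeet => w /sube/hasP[u us emb].
apply: sle_trans (dia_refl _) (sle_trans (eval_sle_branches (Dia s)) _).
exact: sle_trans (bigmeet_sle _ us) (dia_word_embeds emb).
Qed.

End Soundness.

(** * Completeness *)

(* The conjunction of the variables in [tvars] and of the diamond words in [twords]. *)
Record theory : Type := Theory {
  tvars : nat -> Prop;
  twords : seq (seq nat) -> Prop;
  twords_nil : twords [::];
  twords_cons : forall Q w, (forall n, n \in Q -> tvars n) -> twords w -> twords (Q :: w)
}.

Definition theory_le (x y : theory) : Prop :=
  (forall n, tvars y n -> tvars x n) /\ (forall w, twords y w -> twords x w).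

Lemma theory_le_refl x : theory_le x x. Proof. by split. Qed.

Lemma theory_le_trans y x z : theory_le x y -> theory_le y z -> theory_le x z.
Proof. by move=> [vxy wxy] [vyz wyz]; split=> [n /vyz /vxy|w /wyz /wxy]. Qed.

Lemma theory_le_antisym x y : theory_le x y -> theory_le y x -> x = y.
Proof.
case: x y => [V U nilU consU] [V' U' nilU' consU'] [/= vxy wxy] [/= vyx wyx].
have eV : V = V'.
  by apply: functional_extensionality => n; apply: propositional_extensionality; split; auto.
have eU : U = U'.
  by apply: functional_extensionality => w; apply: propositional_extensionality; split; auto.
by subst; rewrite (proof_irrelevance _ nilU nilU') (proof_irrelevance _ consU consU').
Qed.

Inductive word_closure (V : nat -> Prop) (U : seq (seq nat) -> Prop) : seq (seq nat) -> Prop :=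
| closure_nil : word_closure V U [::]
| closure_base w : U w -> word_closure V U w
| closure_cons Q w : (forall n, n \in Q -> V n) -> word_closure V U w ->
    word_closure V U (Q :: w).

Definition generated V U : theory :=
  @Theory V (word_closure V U) (closure_nil V U) (@closure_cons V U).

Lemma theory_le_generated x V U : theory_le x (generated V U) <->
  (forall n, V n -> tvars x n) /\ (forall w, U w -> twords x w).
Proof.
split=> [] [Vx Ux]; split=> // w; first by move=> Uw; apply/Ux/closure_base.
elim=> {w} [|w /Ux //|Q w QV _]; first exact: twords_nil.
by apply: twords_cons => n /QV /Vx.
Qed.

Definition theory_meet x y : theory :=
  generated (fun n => tvars x n \/ tvars y n) (fun w => twords x w \/ twords y w).

Definition theory_top : theory := generated (fun _ => False) (fun _ => False).

Definition theory_dia x : theory := generated (fun _ => False) (twords x).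

Definition theory_var m : theory := generated (fun n => n = m) (fun _ => False).

Lemma theory_le_meet x y z : theory_le z (theory_meet x y) <-> theory_le z x /\ theory_le z y.
Proof.
rewrite theory_le_generated /theory_le; split=> [[v w]|[[vx wx] [vy wy]]].
  by split; split=> [n xn|u xu]; [apply: v|apply: w|apply: v|apply: w]; auto.
by split=> [n [/vx|/vy]|u [/wx|/wy]].
Qed.

Lemma theory_le_top x : theory_le x theory_top.
Proof. by apply/theory_le_generated; split. Qed.

Lemma theory_meetP x y : theory_meet x y = x <-> theory_le x y.
Proof.
have := theory_le_meet x y (theory_meet x y).
case=> /(_ (theory_le_refl _))[lex ley] _; split=> [<- //|xy].
by apply: theory_le_antisym lex _; apply/theory_le_meet; split; first exact: theory_le_refl.
Qed.

Lemma eq_theory x y : (forall z, theory_le z x <-> theory_le z y) -> x = y.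
Proof.
move=> xy; apply: theory_le_antisym.
  exact/xy/theory_le_refl.
exact/(proj2 (xy y))/theory_le_refl.
Qed.

Lemma theory_meetA x y z : theory_meet x (theory_meet y z) = theory_meet (theory_meet x y) z.
Proof. by apply: eq_theory => u; rewrite !theory_le_meet and_assoc. Qed.

Lemma theory_meetC x y : theory_meet x y = theory_meet y x.
Proof. by apply: eq_theory => u; rewrite !theory_le_meet and_comm. Qed.

Lemma twords_dia x w : twords (theory_dia x) w <-> twords x w.
Proof.
split=> [|xw]; last exact: closure_base.
elim=> {w} [|//|Q w noQ _]; first exact: twords_nil.
by apply: twords_cons => n /noQ.
Qed.

Lemma theory_le_dia x y : theory_le x (theory_dia y) <-> (forall w, twords y w -> twords x w).
Proof. by rewrite theory_le_generated; split=> [[]|yx] //; split. Qed.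

Lemma theory_dia_mono x y : theory_meet x y = x ->
  theory_meet (theory_dia x) (theory_dia y) = theory_dia x.
Proof.
move/theory_meetP => [_ yx]; apply/theory_meetP/theory_le_dia => w yw.
exact/twords_dia/yx.
Qed.

Definition theorySLO : SLO :=
  @Build_SLO theory theory_meet theory_top theory_dia theory_meetA theory_meetC
    (fun x => proj2 (theory_meetP x x) (theory_le_refl x))
    (fun x => proj2 (theory_meetP x theory_top) (theory_le_top x)) theory_dia_mono.

Lemma twords_meet_dia_dia x y z w :
  twords (theory_meet x (theory_meet (theory_dia y) (theory_dia z))) w ->
  twords (theory_meet x y) w \/ twords (theory_meet x z) w.
Proof.
have cons_or Q u : (forall n, n \in Q -> tvars x n) ->
    twords (theory_meet x y) u \/ twords (theory_meet x z) u ->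
    twords (theory_meet x y) (Q :: u) \/ twords (theory_meet x z) (Q :: u).
  by move=> Qx [|] h; [left|right]; apply: twords_cons => // n /Qx; left.
elim=> {w} [|w [xw|]|Q w QV _].
- by left; exact: twords_nil.
- by left; apply: closure_base; left.
- elim=> {w} [|w [|] /twords_dia xw|Q w QV _].
  + by left; exact: twords_nil.
  + by left; apply: closure_base; right.
  + by right; apply: closure_base; right.
  + by apply: cons_or => n /QV [].
- by apply: cons_or => n /QV [|[]].
Qed.

Lemma theorySLO_lin s : Sigma_lin s -> valid theorySLO s.
Proof.
case=> [->|[->|->]] v; apply/theory_meetP/theory_le_dia => w //=.
  by move=> xw; do 2!apply: closure_base.
case/twords_meet_dia_dia => xw; apply: closure_base; [left|right]; exact: closure_base.
Qed.

Section BranchTheory.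
Variable f : spf.

Let branch_word w : Prop := has (embeds sub_vars w) (branches (Dia f)).

Lemma branch_word_nil : branch_word [::].
Proof. by []. Qed.

Lemma branch_word_cons Q w : (forall n, n \in Q -> n \in vars f) ->
  branch_word w -> branch_word (Q :: w).
Proof.
move=> /allP Qf /hasP[u fu emb]; apply/hasP; exists u => //.
have [u' eu] : exists u', u = vars f :: u'.
  by move: fu; rewrite inE => /predU1P[->|/mapP[u' _ ->]]; eexists.
by move: emb; rewrite eu embeds_cons skip_to_cons /sub_vars Qf.
Qed.

Definition branch_theory : theory := Theory branch_word_nil branch_word_cons.

End BranchTheory.

Lemma branch_theory_le f g : {subset vars g <= vars f} -> {subset branches g <= branches f} ->
  theory_le (branch_theory f) (branch_theory g).
Proof.
move=> vgf bgf; split=> //= w.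
have fits Q : sub_vars Q (vars g) -> sub_vars Q (vars f).
  by move/sub_vars_trans; apply; exact/allP.
case/orP=> [/(embeds_head fits) -> //|/hasP[_ /mapP[u gu ->]] /(embeds_head fits) emb].
by apply/orP; right; apply/hasP; exists (vars f :: u) => //; apply/map_f/bgf.
Qed.

Lemma branch_theory_dia f w :
  twords (branch_theory f) w -> twords (branch_theory (Dia f)) w.
Proof.
case/hasP=> u fu emb; apply/hasP; exists ([::] :: u); first by rewrite inE map_f ?orbT.
by apply: (embeds_drop (k := 1)); rewrite drop1.
Qed.

Definition theory_eval (f : spf) : theory := eval (A := theorySLO) theory_var f.

Lemma branch_theory_le_eval f : theory_le (branch_theory f) (theory_eval f).
Proof.
elim: f => [m||a IHa b IHb|a [_ IHa]] /=.
- by apply/theory_le_generated; split=> // n ->; exact: mem_head.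
- exact: theory_le_top.
- apply/theory_le_meet; split; [apply: theory_le_trans IHa|apply: theory_le_trans IHb];
    by apply: branch_theory_le => x; rewrite mem_cat => ->; rewrite ?orbT.
- by apply/theory_le_dia => w /IHa /branch_theory_dia.
Qed.

Lemma tvars_eval f n : n \in vars f -> tvars (theory_eval f) n.
Proof.
elim: f => [m||a IHa b IHb|] //=; first by rewrite inE => /eqP.
by rewrite mem_cat => /orP[/IHa|/IHb]; [left|right].
Qed.

Lemma twords_eval f w : w \in branches f -> twords (theory_eval f) w.
Proof.
elim: f w => [m||a IHa b IHb|a IHa] w //=.
  by rewrite mem_cat => /orP[/IHa|/IHb] aw; apply: closure_base; [left|right].
move=> aw; apply/twords_dia; move: aw.
by rewrite inE => /predU1P[->|/mapP[u /IHa au ->]]; apply: twords_cons => //;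
  [exact: tvars_eval|exact: twords_nil|exact: tvars_eval].
Qed.

Theorem SPi_linP i : SPi_lin i <-> lin_criterion i.
Proof.
split=> [lin_i|der A linA v]; last exact: lin_criterion_sle.
have /theory_meetP le_val := lin_i _ theorySLO_lin (theory_var : nat -> car theorySLO).
have [vars_i words_i] := theory_le_trans (branch_theory_le_eval (ante i)) le_val.
apply/andP; split; apply/allP; first by move=> n /tvars_eval /vars_i.
by move=> w /twords_eval /words_i.
Qed.

(** * Turing machines with two exits *)

Definition tok_code (t : tok) : bool * bool * bool :=
  match t with
  | TVar => (false, false, false)
  | TB0 => (false, false, true)
  | TB1 => (false, true, false)
  | TEnd => (false, true, true)
  | TTop => (true, false, false)
  | TAnd => (true, false, true)
  | TDia => (true, true, false)
  | TImp => (true, true, true)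
  end.

Definition tok_decode (c : bool * bool * bool) : tok :=
  match c with
  | (false, false, false) => TVar
  | (false, false, true) => TB0
  | (false, true, false) => TB1
  | (false, true, true) => TEnd
  | (true, false, false) => TTop
  | (true, false, true) => TAnd
  | (true, true, false) => TDia
  | (true, true, true) => TImp
  end.

Lemma tok_codeK : cancel tok_code tok_decode.
Proof. by case. Qed.

HB.instance Definition _ := Finite.copy tok (can_type tok_codeK).

Section Machines.
Variables (G : finType) (bl : G).

Definition tape : Type := (seq G * G * seq G)%type.

Definition mk_tape (l s : seq G) : tape :=
  if s is x :: s' then (l, x, s') else (l, bl, [::]).

Definition move_tape (m : move) (l : seq G) (b : G) (s : seq G) : tape :=
  match m with
  | Stay => (l, b, s)
  | MoveL => if l is x :: l' then (l', x, b :: s) else ([::], bl, b :: s)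
  | MoveR => mk_tape (b :: l) s
  end.

(* The two exits of a machine serve as the two outcomes of a test. *)
Record machine : Type := Machine {
  mstate : finType;
  mstart : mstate;
  mdelta : mstate -> G -> (mstate + bool) * G * move
}.

Definition mstep (M : machine) (c : (mstate M + bool) * tape) : (mstate M + bool) * tape :=
  match c with
  | (inr _, _) => c
  | (inl s, (l, a, s')) => let: (q, b, m) := mdelta s a in (q, move_tape m l b s')
  end.

Definition exec (M : machine) (tp : tape) (b : bool) (tp' : tape) (T : nat) : Prop :=
  exists2 t, t <= T & iter t (@mstep M) (inl (mstart M), tp) = (inr b, tp').

Lemma exec_leq M tp b tp' T T' : T <= T' -> exec M tp b tp' T -> exec M tp b tp' T'.
Proof. by move=> leT [t let_T et]; exists t => //; exact: leq_trans leT. Qed.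

Lemma iter_mstep_inr M t b tp : iter t (@mstep M) (inr b, tp) = (inr b, tp).
Proof. by elim: t => //= t ->. Qed.

Definition relabel (Q Q' : Type) (h : Q -> Q') (out : Q * G * move) : Q' * G * move :=
  let: (q, b, m) := out in (h q, b, m).

Section Simulation.
Variables (M N : machine) (g : mstate M -> mstate N) (h : mstate M + bool -> mstate N + bool).
Hypotheses (h_inl : forall s, h (inl s) = inl (g s))
  (mdelta_g : forall s a, mdelta (g s) a = relabel h (mdelta s a)).

Lemma iter_mstep_simulation t s tp b tp' :
  iter t (@mstep M) (inl s, tp) = (inr b, tp') ->
  exists2 t', t' <= t & iter t' (@mstep N) (inl (g s), tp) = (h (inr b), tp').
Proof.
elim: t s tp => [|t IHt] s [[l a] r] //; rewrite iterSr /=.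
have := mdelta_g s a; case: (mdelta s a) => [[[s'|b'] c] m] /= eN.
  by case/IHt=> t' let't et'; exists t'.+1; rewrite // iterSr /= eN h_inl.
by rewrite iter_mstep_inr => -[<- <-]; exists 1; rewrite //= eN.
Qed.

End Simulation.

Section Ite.
Variables M1 M2 M3 : machine.

Let ite_state : finType := (mstate M1 + (mstate M2 + mstate M3))%type.

Let ite_branch (b : bool) : ite_state :=
  inr (if b then inl (mstart M2) else inr (mstart M3)).

Let of_test (q : mstate M1 + bool) : ite_state + bool :=
  match q with inl s => inl (inl s) | inr b => inl (ite_branch b) end.

Let of_then (q : mstate M2 + bool) : ite_state + bool :=
  match q with inl s => inl (inr (inl s)) | inr b => inr b end.

Let of_else (q : mstate M3 + bool) : ite_state + bool :=
  match q with inl s => inl (inr (inr s)) | inr b => inr b end.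

Definition ite_mach : machine :=
  @Machine ite_state (inl (mstart M1)) (fun s a =>
    match s with
    | inl s => relabel of_test (mdelta s a)
    | inr (inl s) => relabel of_then (mdelta s a)
    | inr (inr s) => relabel of_else (mdelta s a)
    end).

Lemma exec_ite tp b tp1 T1 b' tp2 T2 :
  exec M1 tp b tp1 T1 -> exec (if b then M2 else M3) tp1 b' tp2 T2 ->
  exec ite_mach tp b' tp2 (T1 + T2).
Proof.
case=> t1 le1 /(@iter_mstep_simulation M1 ite_mach inl of_test) [//|//|t1' le1' e1].
move=> exec2.
have [t2 le2 e2] : exists2 t, t <= T2 &
    iter t (@mstep ite_mach) (inl (ite_branch b), tp1) = (inr b', tp2).
  case: b exec2 {e1} => [] [t2 le2].
    case/(@iter_mstep_simulation M2 ite_mach (inr \o inl) of_then) => // t2' le2' e2.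
    by exists t2' => //; exact: leq_trans le2.
  case/(@iter_mstep_simulation M3 ite_mach (inr \o inr) of_else) => // t2' le2' e2.
  by exists t2' => //; exact: leq_trans le2.
by exists (t2 + t1'); [lia | rewrite iterD e1].
Qed.

End Ite.

Section Loop.
Variable M : machine.

Let restart (q : mstate M + bool) : mstate M + bool :=
  match q with
  | inl s => inl s
  | inr b => if b then inl (mstart M) else inr true
  end.

Definition loop_mach : machine :=
  @Machine (mstate M) (mstart M) (fun s a => relabel restart (mdelta s a)).

Lemma exec_loop_exit tp tp' T : exec M tp false tp' T -> exec loop_mach tp true tp' T.
Proof.
case=> t leT /(@iter_mstep_simulation M loop_mach id restart) [//|//|t' let' et'].
by exists t' => //; exact: leq_trans leT.
Qed.

Lemma exec_loop_step tp tp1 T1 b tp2 T2 :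
  exec M tp true tp1 T1 -> exec loop_mach tp1 b tp2 T2 -> exec loop_mach tp b tp2 (T1 + T2).
Proof.
case=> t1 le1 /(@iter_mstep_simulation M loop_mach id restart) [//|//|t1' le1' e1].
by case=> t2 le2 e2; exists (t2 + t1'); [lia | rewrite iterD e1].
Qed.

End Loop.

Definition exit_mach (b : bool) : machine :=
  @Machine unit tt (fun _ a => (inr b, a, Stay)).

Lemma exec_exit b tp : exec (exit_mach b) tp b tp 1.
Proof. by exists 1 => //; case: tp => [[]]. Qed.

Section ToTM.
Variables (inp : tok -> G) (M : machine).

Definition to_TM : TM :=
  @Build_TM (mstate M + bool)%type G bl inp (inl (mstart M))
    (fun s => if s is inr _ then true else false)
    (fun s => if s is inr b then b else false)
    (fun s a => if s is inl s' then mdelta s' a else (s, a, Stay)).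

Let to_config (c : (mstate M + bool) * tape) : config to_TM :=
  let: (s, (l, a, r)) := c in (s, l, a, r).

Lemma step_to_TM c : @step to_TM (to_config c) = to_config (mstep c).
Proof.
case: c => [[s|b] [[l a] r]] //=.
by case: (mdelta s a) => [[s' b] []] //=; [case: l|case: r].
Qed.

Lemma run_to_TM w b tp T : exec M (mk_tape [::] (map inp w)) b tp T ->
  cstate (@run to_TM T w) = inr b.
Proof.
have iter_step t c : iter t (@step to_TM) (to_config c) = to_config (iter t (@mstep M) c).
  by elim: t => //= t ->; exact: step_to_TM.
case=> t leT et; rewrite /run.
have -> : @init to_TM w = to_config (inl (mstart M), mk_tape [::] (map inp w)).
  by rewrite /init /=; case: (map inp w).
rewrite iter_step -(subnK leT) iterD et iter_mstep_inr.
by case: tp {et} => [[]].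
Qed.

End ToTM.

End Machines.

Definition sweep_time (n : nat) : nat := 2 * n + 1.

Section Sweep.
Variables (C : finType) (is_first : pred C).
Variables (S : finType) (f : S -> C -> S * C) (s0 : S) (out : S -> bool).

(* Runs right with [f] as a transducer, then back to the unique [is_first] cell. *)
Definition sweep_mach : machine (option C) :=
  @Machine (option C) (S + bool)%type (inl s0)
    (fun q g => match q, g with
       | inl s, Some c => let: (s', c') := f s c in (inl (inl s'), Some c', MoveR)
       | inl s, None => (inl (inr (out s)), None, MoveL)
       | inr b, Some c => if is_first c then (inr b, g, Stay) else (inl (inr b), g, MoveL)
       | inr b, None => (inl (inr b), g, MoveL)
       end).

Fixpoint transduce (s : S) (cs : seq C) : S * seq C :=
  if cs is c :: cs' then
    let: (s1, c1) := f s c in let: (s2, cs2) := transduce s1 cs' in (s2, c1 :: cs2)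
  else (s, [::]).

Lemma size_transduce s cs : size (transduce s cs).2 = size cs.
Proof.
by elim: cs s => //= c cs IHcs s; case: (f s c) => s1 c1; rewrite -(IHcs s1); case: transduce.
Qed.

Let padded (l : seq (option C)) (cs : seq C) (m : nat) : tape (option C) :=
  mk_tape None l (map some cs ++ nseq m None).

Lemma iter_sweep_right s l cs m :
  iter (size cs) (@mstep _ None sweep_mach) (inl (inl s), padded l cs m) =
  (inl (inl (transduce s cs).1), padded (rev (map some (transduce s cs).2) ++ l) [::] m).
Proof.
elim: cs s l => [//|c cs IHcs] s l; rewrite [size _]/= iterSr /=.
case: (f s c) => s1 c1; rewrite IHcs.
by case: (transduce s1 cs) => s2 cs2 /=; rewrite rev_cons cat_rcons.
Qed.

Lemma iter_sweep_left b c0 ds (x : option C) l r :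
  is_first c0 -> all (predC is_first) ds -> map some (rcons ds c0) = x :: l ->
  iter (size ds).+1 (@mstep _ None sweep_mach) (inl (inr b), (l, x, r)) =
  (inr b, mk_tape None [::] (Some c0 :: rev (map some ds) ++ r)).
Proof.
move=> first0; elim: ds x l r => [|d ds IHds] x l r.
  by move=> _ [<- <-] /=; rewrite first0.
case/andP=> /negbTE d_inner ds_inner [<- <-].
rewrite [size _]/= iterSr [mstep _ _]/= d_inner.
case E: (map some (rcons ds c0)) => [|y l']; first by case: ds {IHds ds_inner} E.
by rewrite (IHds _ _ _ ds_inner E) /= rev_cons cat_rcons.
Qed.

Lemma exec_sweep cs c0 cs1 m s' :
  transduce s0 cs = (s', c0 :: cs1) -> is_first c0 -> all (predC is_first) cs1 ->
  exec None sweep_mach (padded [::] cs m) (out s') (padded [::] (c0 :: cs1) m.-1.+1)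
    (sweep_time (size cs)).
Proof.
move=> eqf first0 inner1; exists ((size cs1).+1 + (1 + size cs)).
  by have := size_transduce s0 cs; rewrite eqf /sweep_time /=; lia.
case E: (map some (rcons (rev cs1) c0)) => [|y l]; first by case: (rev cs1) E.
rewrite !iterD iter_sweep_right eqf [_.1]/= [_.2]/= cats0 -map_rev rev_cons E -(size_rev cs1).
have -> : iter 1 (@mstep _ None sweep_mach) (inl (inl s'), padded (y :: l) [::] m) =
    (inl (inr (out s')), (l, y, None :: nseq m.-1 None)) by case: m.
by rewrite (iter_sweep_left _ _ first0 _ E) ?all_rev // -map_rev revK.
Qed.

End Sweep.

(** * Registers holding input positions *)

Definition input_word (w : seq tok) : bool :=
  if w is t :: w' then (t == TImp) && (TImp \notin w') else false.

Lemma input_word_gt0 w : input_word w -> 0 < size w.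
Proof. by case: w. Qed.

Lemma all_nat_bits (a : pred tok) m : a TB0 -> a TB1 -> all a (nat_bits m).
Proof.
move=> a0 a1; rewrite /nat_bits; case: N.of_nat => // x.
by elim: x => /= [x ->|x ->|]; rewrite ?a0 ?a1.
Qed.

Lemma TImp_notin_enc_f g : TImp \notin enc_f g.
Proof.
elim: g => [m||a IHa b IHb|a IHa] //=; rewrite inE ?mem_cat ?negb_or ?IHa //=.
by rewrite andbT; apply/negP => /(allP (@all_nat_bits (predC1 TImp) m isT isT)).
Qed.

Lemma input_word_enc i : input_word (enc i).
Proof. by rewrite /= mem_cat negb_or !TImp_notin_enc_f. Qed.

Definition tok_at (w : seq tok) (x : nat) : tok := nth TTop w x.
Arguments tok_at : simpl never.

Definition positions (w : seq tok) : seq nat := iota 0 (size w).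

Lemma tok_at_imp w x : input_word w -> (tok_at w x == TImp) = (x == 0).
Proof.
rewrite /tok_at; case: w => // t w /andP[/eqP -> imp_w]; case: x => //= x.
case: (ltnP x (size w)) => [xw|wx]; last by rewrite nth_default.
by apply: contraNF imp_w => /eqP <-; exact: mem_nth.
Qed.

Definition upd (rho : nat -> nat) (i v : nat) : nat -> nat :=
  fun k => if k == i then v else rho k.

Lemma upd_upd rho i u v : upd (upd rho i u) i v =1 upd rho i v.
Proof. by move=> k; rewrite /upd; case: eqP. Qed.

Lemma upd_same rho i v : rho i = v -> upd rho i v =1 rho.
Proof. by move=> <- k; rewrite /upd; case: eqP => [->|]. Qed.

Section Registers.
Variable K : nat.

Definition cell : finType := (tok * {ffun 'I_K.+1 -> bool})%type.
Definition symbol : finType := option cell.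

Definition mark (i : nat) (c : cell) : bool := c.2 (inord i).

Definition set_mark (i : nat) (b : bool) (c : cell) : cell :=
  (c.1, [ffun k => if k == inord i then b else c.2 k]).

(* Register [i] is the mark [i] in cell [rho i]; a value beyond the input leaves no mark. *)
Definition cell_at (w : seq tok) (rho : nat -> nat) (j : nat) : cell :=
  (tok_at w j, [ffun i : 'I_K.+1 => rho i == j]).

Definition cells (w : seq tok) (rho : nat -> nat) : seq cell :=
  [seq cell_at w rho j | j <- positions w].

Lemma mark_cell_at i w rho j : i <= K -> mark i (cell_at w rho j) = (rho i == j).
Proof. by move=> leiK; rewrite /mark ffunE inordK. Qed.

Lemma set_mark_cell_at i w rho j v b : i <= K -> (v == j) = b ->
  set_mark i b (cell_at w rho j) = cell_at w (upd rho i v) j.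
Proof.
move=> leiK <-; congr pair; apply/ffunP => k.
by rewrite !ffunE /upd -val_eqE /= inordK //; case: ifP.
Qed.

Lemma eq_cells w rho rho' : rho =1 rho' -> cells w rho = cells w rho'.
Proof.
move=> eq_rho; apply: eq_map => j; congr pair; apply/ffunP => i.
by rewrite !ffunE eq_rho.
Qed.

Definition tape_of (w : seq tok) (rho : nat -> nat) (tp : tape symbol) : Prop :=
  exists m, tp = mk_tape None [::] (map some (cells w rho) ++ nseq m None).

Definition runs (M : machine symbol) w rho (b : bool) rho' (T : nat) : Prop :=
  forall tp, tape_of w rho tp -> exists2 tp', exec None M tp b tp' T & tape_of w rho' tp'.

Lemma runs_leq M w rho b rho' T T' :
  T <= T' -> runs M w rho b rho' T -> runs M w rho b rho' T'.
Proof. by move=> leT runM tp /runM[tp' e ?]; exists tp'; first exact: exec_leq e. Qed.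

Lemma eq_runs M w rho1 rho1' b rho2 rho2' T :
  rho1 =1 rho1' -> rho2 =1 rho2' -> runs M w rho1 b rho2 T -> runs M w rho1' b rho2' T.
Proof.
move=> eq1 eq2 runM tp; rewrite /tape_of -(eq_cells w eq1) => /runM[tp' e].
by rewrite /tape_of (eq_cells w eq2); exists tp'.
Qed.

Lemma runs_ite M1 M2 M3 w rho b rho1 T1 b' rho2 T2 :
  runs M1 w rho b rho1 T1 -> runs (if b then M2 else M3) w rho1 b' rho2 T2 ->
  runs (ite_mach M1 M2 M3) w rho b' rho2 (T1 + T2).
Proof.
by move=> run1 run2 tp /run1[tp1 e1 /run2[tp2 e2 ?]]; exists tp2; first exact: exec_ite e2.
Qed.

Definition seq_mach (M N : machine symbol) : machine symbol := ite_mach M N N.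

Lemma runs_seq M N w rho b rho1 T1 b' rho2 T2 :
  runs M w rho b rho1 T1 -> runs N w rho1 b' rho2 T2 ->
  runs (seq_mach M N) w rho b' rho2 (T1 + T2).
Proof. by move=> runM runN; apply: runs_ite runM _; case: b. Qed.

Lemma runs_loop_exit M w rho rho' T :
  runs M w rho false rho' T -> runs (loop_mach M) w rho true rho' T.
Proof. by move=> runM tp /runM[tp' e ?]; exists tp'; first exact: exec_loop_exit. Qed.

Lemma runs_loop_step M w rho rho1 T1 b rho2 T2 :
  runs M w rho true rho1 T1 -> runs (loop_mach M) w rho1 b rho2 T2 ->
  runs (loop_mach M) w rho b rho2 (T1 + T2).
Proof.
move=> run1 run2 tp /run1[tp1 e1 /run2[tp2 e2 ?]].
by exists tp2; first exact: exec_loop_step e2.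
Qed.

Lemma runs_exit w rho b : runs (exit_mach symbol b) w rho b rho 1.
Proof. by move=> tp ?; exists tp; first exact: exec_exit. Qed.

Definition is_imp (c : cell) : bool := c.1 == TImp.

Lemma is_imp_cell_at w rho j : input_word w -> is_imp (cell_at w rho j) = (j == 0).
Proof. exact: tok_at_imp. Qed.

(* The transducer is in state [st j] when it reaches position [j]. *)
Lemma runs_sweep (S : finType) (f : S -> cell -> S * cell) (st : nat -> S) out w rho rho' :
  input_word w ->
  (forall j, j < size w -> f (st j) (cell_at w rho j) = (st j.+1, cell_at w rho' j)) ->
  runs (sweep_mach is_imp f (st 0) out) w rho (out (st (size w))) rho' (sweep_time (size w)).
Proof.
move=> imp_w f_st tp [m ->].
have trans j k : j + k <= size w -> transduce f (st j) [seq cell_at w rho i | i <- iota j k] =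
    (st (j + k), [seq cell_at w rho' i | i <- iota j k]).
  elim: k j => [|k IHk] j /= lejk; first by rewrite addn0.
  by rewrite f_st ?IHk ?addSnnS //; lia.
have w_gt0 := input_word_gt0 imp_w.
have cells_w : cells w rho' =
    cell_at w rho' 0 :: [seq cell_at w rho' j | j <- iota 1 (size w).-1].
  by rewrite /cells /positions -{1}(prednK w_gt0).
have := trans 0 _ (leqnn _); rewrite add0n -/(positions w) -/(cells w rho) -/(cells w rho').
rewrite cells_w => trans_w; eexists; last by exists m.-1.+1.
have := @exec_sweep _ is_imp _ _ _ out _ _ _ m _ trans_w; rewrite size_map size_iota cells_w.
apply; first by rewrite is_imp_cell_at.
by apply/allP => _ /mapP[j + ->]; rewrite mem_iota /= is_imp_cell_at //; lia.
Qed.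

Definition tok_mach (i : nat) (a : tok) : machine symbol :=
  sweep_mach is_imp (fun b c => (if mark i c then c.1 == a else b, c)) (TTop == a) id.

Definition lt_mach (i j : nat) : machine symbol :=
  sweep_mach is_imp
    (fun s c => let seen_j := s.1 || mark j c in
      ((seen_j, if mark i c then ~~ seen_j else s.2), c)) (false, false) snd.

Definition zero_mach (i : nat) : machine symbol :=
  sweep_mach is_imp (fun b c => (false, set_mark i b c)) true xpredT.

Definition clear_mach (i : nat) : machine symbol :=
  sweep_mach is_imp (fun u c => (u, set_mark i false c)) tt xpredT.

Definition copy_mach (i j : nat) : machine symbol :=
  sweep_mach is_imp (fun u c => (u, set_mark j (mark i c) c)) tt xpredT.

Definition incr_mach (i : nat) : machine symbol :=
  sweep_mach is_imp (fun b c => (mark i c, set_mark i b c)) false xpredT.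

Definition bool_mach (i : nat) (b : bool) : machine symbol :=
  if b then seq_mach (zero_mach i) (incr_mach i) else zero_mach i.

Section Primitives.
Variables (w : seq tok) (rho : nat -> nat) (i : nat).
Hypotheses (imp_w : input_word w) (leiK : i <= K).
Notation n := (size w).
Notation T := (sweep_time (size w)).

Lemma runs_tok a : runs (tok_mach i a) w rho (tok_at w (rho i) == a) rho T.
Proof.
pose st j := (if rho i < j then tok_at w (rho i) else TTop) == a.
have -> : (tok_at w (rho i) == a) = st n.
  by rewrite /st; case: ltnP => // /(nth_default TTop) <-.
apply: (runs_sweep (st := st)) => // j _; rewrite mark_cell_at // /st ltnS.
by case: ltngtP => // <-.
Qed.

Lemma runs_lt j : j <= K -> rho j <= n -> runs (lt_mach i j) w rho (rho i < rho j) rho T.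
Proof.
move=> lejK lejn; pose st k := (rho j < k, (rho i < k) && (rho i < rho j)).
have -> : (rho i < rho j) = (st n).2 by rewrite /= andb_idl //; lia.
apply: (runs_sweep (st := st)) => // k _; rewrite !mark_cell_at // /st /=.
by congr (_, _, _); [lia | case: eqP => [->|] /=; lia].
Qed.

Lemma runs_zero : runs (zero_mach i) w rho true (upd rho i 0) T.
Proof.
apply: (runs_sweep (st := fun j => j == 0)) => // j _.
by rewrite (@set_mark_cell_at _ _ _ _ 0).
Qed.

Lemma runs_clear : runs (clear_mach i) w rho true (upd rho i n) T.
Proof.
apply: (runs_sweep (st := fun _ => tt)) => // j ltjn.
by rewrite (@set_mark_cell_at _ _ _ _ n) //; lia.
Qed.

Lemma runs_copy j : j <= K -> runs (copy_mach i j) w rho true (upd rho j (rho i)) T.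
Proof.
move=> lejK; apply: (runs_sweep (st := fun _ => tt)) => // k _.
by rewrite (@set_mark_cell_at _ _ _ _ (rho i)) ?mark_cell_at.
Qed.

Lemma runs_incr : runs (incr_mach i) w rho true (upd rho i (minn (rho i).+1 n)) T.
Proof.
apply: (runs_sweep (st := fun j => (rho i).+1 == j)) => // j ltjn.
by rewrite mark_cell_at // (@set_mark_cell_at _ _ _ _ (minn (rho i).+1 n)) //; lia.
Qed.

End Primitives.

Lemma runs_bool w rho i b : input_word w -> i <= K ->
  runs (bool_mach i b) w rho true (upd rho i b) (2 * sweep_time (size w)).
Proof.
move=> imp_w leiK; have w_gt0 := input_word_gt0 imp_w.
rewrite mul2n -addnn; case: b; last by apply: runs_leq (leq_addr _ _) (runs_zero imp_w leiK).
apply: runs_seq (runs_zero imp_w leiK) _.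
apply: eq_runs (runs_incr imp_w leiK) => // k.
by rewrite upd_upd /upd eqxx (minn_idPl w_gt0).
Qed.

Definition test_mach (M : machine symbol) (i : nat) : machine symbol :=
  ite_mach M (bool_mach i true) (bool_mach i false).

Lemma runs_test M w rho b rho' T i : input_word w -> i <= K -> runs M w rho b rho' T ->
  runs (test_mach M i) w rho true (upd rho' i b) (T + 2 * sweep_time (size w)).
Proof. by move=> imp_w leiK runM; apply: runs_ite runM _; case: b; exact: runs_bool. Qed.

End Registers.

(** * Position functions computable in polynomial time *)

Definition poly_bounded (T : nat -> nat) : Prop := exists c k, forall n, T n <= c * n.+1 ^ k.

Lemma poly_bounded_const c : poly_bounded (fun _ => c).
Proof. by exists c, 0 => n; rewrite muln1. Qed.

Lemma poly_bounded_id : poly_bounded (fun n => n).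
Proof. by exists 1, 1 => n; rewrite mul1n expn1. Qed.

Lemma poly_bounded_add T1 T2 :
  poly_bounded T1 -> poly_bounded T2 -> poly_bounded (fun n => T1 n + T2 n).
Proof.
move=> [c1 [k1 le1]] [c2 [k2 le2]]; exists (c1 + c2), (k1 + k2) => n; rewrite mulnDl.
apply: leq_add; [apply: leq_trans (le1 n) _|apply: leq_trans (le2 n) _];
  by rewrite leq_mul2l leq_pexp2l ?orbT ?leq_addr ?leq_addl.
Qed.

Lemma poly_bounded_mul T1 T2 :
  poly_bounded T1 -> poly_bounded T2 -> poly_bounded (fun n => T1 n * T2 n).
Proof.
move=> [c1 [k1 le1]] [c2 [k2 le2]]; exists (c1 * c2), (k1 + k2) => n.
by rewrite expnD mulnACA leq_mul.
Qed.

Lemma poly_bounded_sweep_time : poly_bounded sweep_time.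
Proof.
apply: poly_bounded_add (poly_bounded_const 1).
exact: poly_bounded_mul (poly_bounded_const 2) poly_bounded_id.
Qed.

Create HintDb poly.
#[local] Hint Resolve poly_bounded_const poly_bounded_id poly_bounded_sweep_time
  poly_bounded_add poly_bounded_mul : poly.

(* A free register holds [n] and so leaves no mark. *)
Definition free_from (n D : nat) (rho : nat -> nat) : Prop :=
  (forall i, rho i <= n) /\ (forall i, D <= i -> rho i = n).

Lemma free_from_upd n D rho v :
  v <= n -> free_from n D rho -> free_from n D.+1 (upd rho D v).
Proof.
move=> len [le_rho off]; split=> i; rewrite /upd; case: eqP => // neqD leDi.
  by lia.
by apply: off; lia.
Qed.

Lemma map_upd rho D v s : all (gtn D) s -> map (upd rho D v) s = map rho s.
Proof.
move=> /allP ltD; apply/eq_in_map => i /ltD /= ltiD.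
by rewrite /upd ltn_eqF.
Qed.

Lemma all_ltnW D s : all (gtn D) s -> all (gtn D.+1) s.
Proof. by apply: sub_all => i /ltnW. Qed.

Lemma all_map_free n D rho s : free_from n D rho -> all (leq^~ n) (map rho s).
Proof. by case=> le_rho _; apply/allP => _ /mapP[i _ ->]. Qed.

(* [M] reads the arguments of [F] in the registers [loc] and writes the result to
   register [D]; the registers above [D] are scratch space. *)
Definition implements (K D : nat) (loc : seq nat) (M : machine (symbol K))
    (F : seq tok -> seq nat -> nat) : Prop :=
  exists2 T, poly_bounded T & forall w rho, input_word w -> free_from (size w) D rho ->
    runs M w rho true (upd rho D (F w (map rho loc))) (T (size w)).

(* The value [size w] stands for "no position".  The arguments of [F] form a list; a
   binder in the lemmas below pushes the bound variable on top of that list. *)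
Definition computes (F : seq tok -> seq nat -> nat) : Prop :=
  (forall w e, input_word w -> all (leq^~ (size w)) e -> F w e <= size w) /\
  exists m, forall K D loc, D + m <= K -> all (gtn D) loc ->
    exists M : machine (symbol K), implements D loc M F.

Definition decides (P : seq tok -> seq nat -> bool) : Prop :=
  computes (fun w e => nat_of_bool (P w e)).

Lemma leq_bool_size (b : bool) w : input_word w -> b <= size w.
Proof. by move/input_word_gt0; exact: leq_trans (leq_b1 b). Qed.

Lemma eq_computes F F' :
  (forall w e, input_word w -> all (leq^~ (size w)) e -> F w e = F' w e) ->
  computes F -> computes F'.
Proof.
move=> eqF [leF [m implF]]; split=> [w e imp_w le_e|]; first by rewrite -eqF ?leF.
exists m => K D loc leK lt_loc; have [M [T polyT runM]] := implF K D loc leK lt_loc.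
exists M, T => // w rho imp_w free; rewrite -eqF //; last exact: all_map_free free.
exact: runM.
Qed.

Lemma computes_zero : computes (fun _ _ => 0).
Proof.
split=> //; exists 0 => K D loc leK _; rewrite addn0 in leK.
by exists (zero_mach K D), sweep_time; [auto with poly|move=> *; exact: runs_zero].
Qed.

Lemma computes_head : computes (fun _ e => head 0 e).
Proof.
split=> [w [|x e] imp_w //= /andP[] //|]; exists 0 => K D loc leK; rewrite addn0 in leK.
case: loc => [|i loc] /= lt_loc.
  by exists (zero_mach K D), sweep_time; [auto with poly|move=> *; exact: runs_zero].
exists (copy_mach K i D), sweep_time; [by auto with poly|move=> *].
by apply: runs_copy => //; lia.
Qed.

Lemma computes_behead F : computes F -> computes (fun w e => F w (behead e)).
Proof.
have all_behead (T : Type) (a : pred T) s : all a s -> all a (behead s).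
  by case: s => //= x s /andP[].
move=> [leF [m implF]]; split=> [w e imp_w /all_behead|]; first exact: leF.
exists m => K D loc leK /all_behead lt_loc.
have [M [T polyT runM]] := implF K D _ leK lt_loc.
by exists M, T => // w rho; rewrite behead_map; exact: runM.
Qed.

Lemma computes_succ F : computes F -> computes (fun w e => minn (F w e).+1 (size w)).
Proof.
move=> [leF [m implF]]; split=> [w e _ _|]; first exact: geq_minr.
exists m => K D loc leK lt_loc; have [M [T polyT runM]] := implF K D loc leK lt_loc.
exists (seq_mach M (incr_mach K D)), (fun n => T n + sweep_time n); first by auto with poly.
move=> w rho imp_w free; apply: runs_seq (runM _ _ imp_w free) _.
apply: eq_runs (runs_incr imp_w _) => [//|i|]; last by lia.
by rewrite upd_upd /upd eqxx.
Qed.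

Lemma runs_clear_upd K w rho D v : input_word w -> D <= K -> free_from (size w) D rho ->
  runs (clear_mach K D) w (upd rho D v) true rho (sweep_time (size w)).
Proof.
move=> imp_w leK [_ off]; apply: eq_runs (runs_clear imp_w leK) => // i.
by rewrite upd_upd upd_same // off.
Qed.

Lemma computes_if C F G : decides C -> computes F -> computes G ->
  computes (fun w e => if C w e then F w e else G w e).
Proof.
move=> [_ [mC implC]] [leF [mF implF]] [leG [mG implG]].
split=> [w e imp_w le_e|]; first by case: ifP => _; [exact: leF|exact: leG].
exists (maxn mC (maxn mF mG)) => K D loc leK lt_loc.
have [|MC [TC polyC runC]] := implC K D loc _ lt_loc; first by lia.
have [|MF [TF polyF runF]] := implF K D loc _ lt_loc; first by lia.
have [|MG [TG polyG runG]] := implG K D loc _ lt_loc; first by lia.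
pose clear_then M := seq_mach (clear_mach K D) M.
exists (seq_mach MC (ite_mach (tok_mach K D TImp) (clear_then MG) (clear_then MF))).
exists (fun n => TC n + (sweep_time n + (sweep_time n + (TF n + TG n)))).
  by auto 7 with poly.
move=> w rho imp_w free; have leDK : D <= K by lia.
apply: runs_seq (runC _ _ imp_w free) _; apply: runs_ite (runs_tok imp_w leDK _) _.
rewrite tok_at_imp // /upd eqxx; case: (C w _) => /=.
  apply: runs_seq (runs_clear_upd imp_w leDK free) _.
  by apply: runs_leq (leq_addr _ _) (runF _ _ imp_w free).
apply: runs_seq (runs_clear_upd imp_w leDK free) _.
by apply: runs_leq (leq_addl _ _) (runG _ _ imp_w free).
Qed.

Lemma decides_tok F a : computes F -> decides (fun w e => tok_at w (F w e) == a).
Proof.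
move=> [leF [m implF]]; split=> [w e imp_w _|]; first exact: leq_bool_size.
exists m => K D loc leK lt_loc; have [M [T polyT runM]] := implF K D loc leK lt_loc.
exists (seq_mach M (test_mach (tok_mach K D a) D)).
exists (fun n => T n + (sweep_time n + 2 * sweep_time n)); first by auto 7 with poly.
move=> w rho imp_w free; have leDK : D <= K by lia.
apply: runs_seq (runM _ _ imp_w free) _.
apply: eq_runs (runs_test imp_w leDK (runs_tok imp_w leDK a)) => // i.
by rewrite upd_upd {2}/upd eqxx.
Qed.

Lemma decides_ltn F G : computes F -> computes G -> decides (fun w e => F w e < G w e).
Proof.
move=> [leF [mF implF]] [leG [mG implG]]; split=> [w e imp_w _|].
  exact: leq_bool_size.
exists (maxn mF mG.+1) => K D loc leK lt_loc.
have [|MF [TF polyF runF]] := implF K D loc _ lt_loc; first by lia.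
have [|MG [TG polyG runG]] := implG K D.+1 loc _ (all_ltnW lt_loc); first by lia.
exists (seq_mach MF (seq_mach MG
  (seq_mach (test_mach (lt_mach K D D.+1) D) (clear_mach K D.+1)))).
exists (fun n => TF n + (TG n + ((sweep_time n + 2 * sweep_time n) + sweep_time n))).
  by auto 8 with poly.
move=> w rho imp_w free; have [leDK leD1K] : D <= K /\ D.+1 <= K by lia.
have le_rho := all_map_free loc free.
have freeF := free_from_upd (leF _ _ imp_w le_rho) free.
apply: runs_seq (runF _ _ imp_w free) _; apply: runs_seq (runG _ _ imp_w freeF) _.
rewrite map_upd //; set x := F _ _; set y := G _ _.
apply: (@runs_seq _ _ _ _ _ true (upd (upd rho D (x < y)) D.+1 y)).
  have [regD regD1] : upd (upd rho D x) D.+1 y D = x /\ upd (upd rho D x) D.+1 y D.+1 = y.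
    by rewrite /upd !eqxx ltn_eqF.
  apply: eq_runs (runs_test imp_w leDK (runs_lt imp_w leDK leD1K _)) => //.
    by move=> i; rewrite regD regD1 /upd; case: eqP => // ->; rewrite ltn_eqF.
  by rewrite regD1 leG.
apply: runs_clear_upd => //; apply: free_from_upd free.
exact: leq_bool_size.
Qed.

Section Fold.
Variables (K D : nat) (M : machine (symbol K)).

Definition fold_body : machine (symbol K) :=
  seq_mach M (seq_mach (copy_mach K D.+2 D) (seq_mach (clear_mach K D.+2) (incr_mach K D.+1))).

(* The accumulator is in register [D] and the loop variable in [D.+1]; register
   [D.+2], being free, holds the loop bound. *)
Definition fold_loop : machine (symbol K) :=
  loop_mach (ite_mach (lt_mach K D.+1 D.+2) fold_body (exit_mach _ false)).

Variables (w : seq tok) (rho : nat -> nat) (step : nat -> nat -> nat) (t : nat).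
Notation n := (size w).

Let regs a x := upd (upd rho D a) D.+1 x.

Hypotheses (leK : D.+2 <= K) (imp_w : input_word w) (free : free_from n D rho).
Hypothesis step_leq : forall a x, a <= n -> x <= n -> step a x <= n.
Hypothesis runM : forall a x, a <= n -> x <= n ->
  runs M w (regs a x) true (upd (regs a x) D.+2 (step a x)) t.

Lemma regs_free a x : regs a x D.+2 = n.
Proof. by case: free => _ off; rewrite /regs /upd !gtn_eqF ?off //; lia. Qed.

Lemma runs_fold_body a x : a <= n -> x < n ->
  runs fold_body w (regs a x) true (regs (step a x) x.+1) (t + 3 * sweep_time n).
Proof.
move=> lean ltxn; have [leK0 leK1] : D <= K /\ D.+1 <= K by lia.
have -> : t + 3 * sweep_time n = t + (sweep_time n + (sweep_time n + sweep_time n)) by lia.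
apply: runs_seq (runM lean (ltnW ltxn)) _; apply: runs_seq (runs_copy imp_w leK leK0) _.
apply: (@runs_seq _ _ _ _ _ true (regs (step a x) x)).
  apply: eq_runs (runs_clear imp_w leK) => // k.
  rewrite {1}/upd; case: eqP => [->|/eqP/negbTE neqk]; first by rewrite regs_free.
  by rewrite /regs /upd eqxx neqk; case: eqP => // ->; rewrite ltn_eqF.
apply: eq_runs (runs_incr imp_w leK1) => // k; rewrite /regs /upd eqxx.
by case: eqP => //; rewrite (minn_idPl ltxn).
Qed.

Lemma runs_fold_loop k a x : a <= n -> x + k = n ->
  runs fold_loop w (regs a x) true (regs (foldl step a (iota x k)) n)
    ((k + 1) * (t + 4 * sweep_time n)).
Proof.
have leK1 : D.+1 <= K by lia.
have run_test b y : runs (lt_mach K D.+1 D.+2) w (regs b y) (y < n) (regs b y) (sweep_time n).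
  have := @runs_lt K w (regs b y) D.+1 imp_w leK1 D.+2 leK.
  by rewrite regs_free {2}/regs /upd eqxx; apply.
elim: k a x => [|k IHk] a x lean /= eqn.
  have -> : x = n by lia.
  apply: runs_loop_exit; apply: (@runs_leq _ _ _ _ _ _ (sweep_time n + 1)).
    by rewrite /sweep_time; lia.
  by apply: runs_ite (run_test a n) _; rewrite ltnn; exact: runs_exit.
have ltxn : x < n by lia.
apply: (@runs_leq _ _ _ _ _ _ ((sweep_time n + (t + 3 * sweep_time n)) +
    (k + 1) * (t + 4 * sweep_time n))); first by lia.
apply: runs_loop_step; last by apply: IHk; [apply: step_leq; lia|lia].
by apply: runs_ite (run_test a x) _; rewrite ltxn; exact: runs_fold_body.
Qed.

End Fold.

Lemma computes_foldl F G : computes F ->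
  computes (fun w e => G w (behead (behead e)) (head 0 e) (head 0 (behead e))) ->
  computes (fun w e => foldl (G w e) (F w e) (positions w)).
Proof.
move=> [leF [mF implF]] [leG [mG implG]].
have leGe w e a x : input_word w -> all (leq^~ (size w)) e -> a <= size w -> x <= size w ->
    G w e a x <= size w.
  by move=> imp_w le_e lea lex; apply: (leG w [:: a, x & e]) => //=; rewrite lea lex.
split=> [w e imp_w le_e|].
  have: all (leq^~ (size w)) (positions w) by apply/allP => x; rewrite mem_iota /=; lia.
  have := leF w e imp_w le_e; elim: (positions w) (F w e) => //= x s IHs a lea /andP[lex les].
  by apply: IHs les; exact: leGe.
exists (maxn mF mG.+2) => K D loc leK lt_loc.
have [|MF [TF polyF runF]] := implF K D loc _ lt_loc; first by lia.
have lt_loc2 : all (gtn D.+2) [:: D, D.+1 & loc] by rewrite /= ltnSn ltnW // !all_ltnW.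
have [|MG [TG polyG runG]] := implG K D.+2 _ _ lt_loc2; first by lia.
have [leK0 leK1 leK2] : [/\ D <= K, D.+1 <= K & D.+2 <= K] by split; lia.
exists (seq_mach MF (seq_mach (zero_mach K D.+1) (fold_loop D MG))).
exists (fun n => TF n + (sweep_time n + (n + 1) * (TG n + 4 * sweep_time n))).
  by auto 8 with poly.
move=> w rho imp_w free; have le_rho := all_map_free loc free.
apply: runs_seq (runF _ _ imp_w free) _; apply: runs_seq (runs_zero imp_w leK1) _.
apply: (eq_runs (frefl _)); last first.
  apply: (runs_fold_loop (step := G w (map rho loc)) leK2 imp_w free) => [a x|a x lea lex||].
  - exact: leGe.
  - have := runG w (upd (upd rho D a) D.+1 x) imp_w; rewrite [map _ [:: _, _ & _]]/=.
    have [-> ->] : upd (upd rho D a) D.+1 x D = a /\ upd (upd rho D a) D.+1 x D.+1 = x.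
      by rewrite /upd !eqxx ltn_eqF.
    by rewrite !map_upd ?all_ltnW //; apply; exact: free_from_upd lex (free_from_upd lea free).
  - exact: leF.
  - exact: add0n.
by move=> i; rewrite upd_same // /upd gtn_eqF //; case: free => _ ->.
Qed.

Lemma poly_time_decidable_input (P : spi -> Prop) (Q : seq tok -> bool) :
  decides (fun w _ => Q w) -> (forall i, Q (enc i) <-> P i) -> poly_time_decidable P.
Proof.
move=> [_ [m implQ]] QP.
have [M [T polyT runM]] := implQ m 0 [::] (leqnn m) isT.
pose N := ite_mach (seq_mach M (tok_mach m 0 TImp)) (exit_mach _ false) (exit_mach _ true).
have [c [k leT]] : poly_bounded (fun n => T n + sweep_time n + 1) by auto with poly.
pose inp (t : tok) : symbol m := Some (t, [ffun => false]).
exists (to_TM None inp N), c, k => i; set w := enc i.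
have imp_w : input_word w := input_word_enc i.
pose rho (j : nat) := size w; have free : free_from (size w) 0 rho by split.
have runN : runs N w rho (Q w) (upd rho 0 (Q w)) (T (size w) + sweep_time (size w) + 1).
  apply: runs_ite (runs_seq (runM w rho imp_w free) (runs_tok imp_w (leq0n m) TImp)) _.
  by rewrite tok_at_imp // /upd eqxx; case: (Q w); exact: runs_exit.
have tape_w : tape_of w rho (mk_tape None [::] (map inp w)).
  exists 0; rewrite cats0 -map_comp; congr mk_tape.
  rewrite -{1}[w](mkseq_nth TTop) -map_comp; apply/eq_in_map => j; rewrite mem_iota => ltjw /=.
  by congr (Some (_, _)); apply/ffunP => l; rewrite !ffunE gtn_eqF.
have [tp ex _] := runN _ tape_w.
rewrite (run_to_TM (exec_leq (leT _) ex)) /=.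
by split=> //; exact: QP.
Qed.

Lemma eq_decides P Q :
  (forall w e, input_word w -> all (leq^~ (size w)) e -> P w e = Q w e) ->
  decides P -> decides Q.
Proof. by move=> eqP; apply: eq_computes => w e imp_w le_e; rewrite eqP. Qed.

Lemma decides_const (b : bool) : decides (fun _ _ => b).
Proof.
case: b; last exact: computes_zero.
apply: eq_computes (computes_succ computes_zero) => w e imp_w _.
exact/minn_idPl/input_word_gt0.
Qed.

Lemma decides_if C P Q : decides C -> decides P -> decides Q ->
  decides (fun w e => if C w e then P w e else Q w e).
Proof.
by move=> dC dP dQ; apply: eq_computes (computes_if dC dP dQ) => w e _ _; case: ifP.
Qed.

Lemma decides_not P : decides P -> decides (fun w e => ~~ P w e).
Proof.
move=> dP; apply: eq_decides (decides_if dP (decides_const false) (decides_const true)).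
by move=> w e _ _; case: ifP.
Qed.

Lemma decides_and P Q : decides P -> decides Q -> decides (fun w e => P w e && Q w e).
Proof. by move=> dP dQ; apply: decides_if dP dQ (decides_const false). Qed.

Lemma decides_or P Q : decides P -> decides Q -> decides (fun w e => P w e || Q w e).
Proof. by move=> dP dQ; apply: decides_if dP (decides_const true) dQ. Qed.

Lemma decides_leq F G : computes F -> computes G -> decides (fun w e => F w e <= G w e).
Proof.
move=> cF cG; apply: eq_decides (decides_not (decides_ltn cG cF)) => w e _ _.
by rewrite -leqNgt.
Qed.

Lemma computes_count P : decides (fun w e => P w (behead e) (head 0 e)) ->
  computes (fun w e => count (P w e) (positions w)).
Proof.
move=> dP; pose step w e a x := if P w e x then minn a.+1 (size w) else a.
apply: eq_computes (computes_foldl (G := step) computes_zero _) => [w e _ _|]; last first.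
  exact: computes_if (computes_behead dP) (computes_succ computes_head) computes_head.
have foldl_count s a : a + size s <= size w -> foldl (step w e) a s = a + count (P w e) s.
  elim: s a => [|x s IHs] a /=; first by rewrite addn0.
  by rewrite /step; case: (P w e x) => le_as; rewrite IHs; lia.
by rewrite foldl_count // size_iota.
Qed.

Lemma computes_size : computes (fun w _ => size w).
Proof.
have count_all := computes_count (P := fun _ _ _ => true) (decides_const true).
by apply: eq_computes count_all => w e _ _; rewrite count_predT size_iota.
Qed.

Lemma computes_minn F G : computes F -> computes G ->
  computes (fun w e => minn (F w e) (G w e)).
Proof. by move=> cF cG; exact: computes_if (decides_ltn cF cG) cF cG. Qed.

Lemma computes_find P : decides (fun w e => P w (behead e) (head 0 e)) ->
  computes (fun w e => find (P w e) (positions w)).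
Proof.
move=> dP; pose step w e a x := if P w e x then minn a x else a.
apply: eq_computes (computes_foldl (G := step) computes_size _) => [w e _ _|]; last first.
  apply: computes_if (computes_behead dP) (computes_minn computes_head _) computes_head.
  exact: computes_behead computes_head.
have foldl_stop i k a : a <= i -> foldl (step w e) a (iota i k) = a.
  elim: k i => //= k IHk i leai; rewrite {2}/step (minn_idPl leai) if_same IHk //; lia.
suff foldl_find i k : i + k = size w -> foldl (step w e) (size w) (iota i k) =
    i + find (P w e) (iota i k) by rewrite foldl_find.
elim: k i => [|k IHk] i eqn /=; first by rewrite eqn.
rewrite {2}/step; case: (P w e i); last by rewrite IHk; lia.
by rewrite addn0 (minn_idPr _) ?foldl_stop //; lia.
Qed.

Lemma computes_addn F G : computes F -> computes G ->
  computes (fun w e => minn (F w e + G w e) (size w)).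
Proof.
move=> cF cG; pose step w e a x := if x < G w e then minn a.+1 (size w) else a.
have [[leF _] [leG _]] := (cF, cG).
apply: eq_computes (computes_foldl (G := step) cF _) => [w e imp_w le_e|]; last first.
  apply: computes_if (decides_ltn _ (computes_behead (computes_behead cG))) _ computes_head.
    exact: computes_behead computes_head.
  exact: computes_succ computes_head.
have foldl_add i k a : i + k = size w -> a <= size w ->
    foldl (step w e) a (iota i k) = minn (a + (G w e - i)) (size w).
  elim: k i a => [|k IHk] i a eqn lea /=; first by have := leG w e imp_w le_e; lia.
  by rewrite {2}/step; case: ltnP => ltxG; rewrite IHk; lia.
by rewrite foldl_add ?subn0 // leF.
Qed.

Lemma decides_has P : decides (fun w e => P w (behead e) (head 0 e)) ->
  decides (fun w e => has (P w e) (positions w)).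
Proof.
move=> dP; apply: eq_decides (decides_ltn computes_zero (computes_count dP)) => w e _ _.
by rewrite has_count.
Qed.

Lemma decides_all P : decides (fun w e => P w (behead e) (head 0 e)) ->
  decides (fun w e => all (P w e) (positions w)).
Proof.
move=> dP; apply: eq_decides (decides_not (decides_has (P := fun w e x => ~~ P w e x) _)).
  by move=> w e _ _; rewrite has_predC negbK.
exact: decides_not.
Qed.

Lemma decides_has_filter P Q :
  decides (fun w e => P w (behead e) (head 0 e)) ->
  decides (fun w e => Q w (behead e) (head 0 e)) ->
  decides (fun w e => has (P w e) [seq x <- positions w | Q w e x]).
Proof.
move=> dP dQ; apply: eq_decides (decides_has (P := fun w e x => P w e x && Q w e x) _).
  by move=> w e _ _; rewrite -!size_filter_gt0 -filter_predI.
exact: decides_and.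
Qed.

Lemma decides_all_filter P Q :
  decides (fun w e => P w (behead e) (head 0 e)) ->
  decides (fun w e => Q w (behead e) (head 0 e)) ->
  decides (fun w e => all (P w e) [seq x <- positions w | Q w e x]).
Proof.
move=> dP dQ; apply: eq_decides (decides_all (P := fun w e x => ~~ Q w e x || P w e x) _).
  by move=> w e _ _; rewrite all_filter; apply: eq_all => x; rewrite /= implybE.
by apply: decides_or => //; exact: decides_not.
Qed.

Lemma decides_eq_tok F G : computes F -> computes G ->
  decides (fun w e => tok_at w (F w e) == tok_at w (G w e)).
Proof.
move=> cF cG.
have decides_has_tok (s : seq tok) :
    decides (fun w e => has (fun a => (tok_at w (F w e) == a) && (tok_at w (G w e) == a)) s).
  elim: s => [|a s IHs] /=; first exact: decides_const.
  by apply: decides_or IHs; apply: decides_and; exact: decides_tok.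
apply: eq_decides (decides_has_tok (enum {: tok})) => w e _ _.
by apply/hasP/eqP => [[a _ /andP[/eqP-> /eqP->]] //|->]; exists (tok_at w (G w e));
  rewrite ?mem_enum ?eqxx.
Qed.

(* An argument may be used under up to three more binders. *)
Ltac weakening c := first
  [ exact c
  | exact (computes_behead c)
  | exact (computes_behead (computes_behead c))
  | exact (computes_behead (computes_behead (computes_behead c))) ].

Create HintDb computability discriminated.

#[local] Hint Resolve decides_tok decides_eq_tok decides_ltn decides_leq
  decides_not decides_and decides_or
  decides_has decides_all decides_has_filter decides_all_filter
  computes_count computes_find computes_zero : computability.
#[local] Hint Extern 0 (computes _) => weakening computes_head : computability.
#[local] Hint Extern 0 (computes _) =>
  match goal with c : computes _ |- _ => weakening c end : computability.

(** * The criterion in terms of input positions *)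

Definition leaf_tok (t : tok) : bool := (t == TTop) || (t == TEnd).

(* The root of the antecedent is treated as a diamond, represented by [TImp]. *)
Definition node_tok (t : tok) : bool := (t == TDia) || (t == TImp).

Section Positions.
Variable w : seq tok.

Definition tok_count (a : pred tok) (x z : nat) : nat :=
  count (fun y => (x < y) && (y <= z) && a (tok_at w y)) (positions w).

(* The last position of the formula that starts right after [x]: in Polish notation
   this is where the leaves first outnumber the conjunctions. *)
Definition arg_end (x : nat) : nat :=
  find (fun z => tok_count (pred1 TAnd) x z < tok_count leaf_tok x z) (positions w).

Definition ancestor (x y : nat) : bool :=
  node_tok (tok_at w x) && ((x <= y) && (y <= arg_end x)).

Definition own_vars (x : nat) : seq nat :=
  [seq v <- positions w | (tok_at w v == TVar) &&
    (ancestor x v && ~~ has (fun z => (x < z) && ancestor z v) (positions w))].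

Definition same_name (v v' : nat) : bool :=
  all (fun k => has (fun j => (j < k) && (tok_at w (v + j) == TEnd)) (positions w) ||
                (tok_at w (v + k) == tok_at w (v' + k))) (positions w).

Definition has_var (x v : nat) : bool := has (same_name v) (own_vars x).

Definition vars_sub (x x' : nat) : bool := all (has_var x') (own_vars x).

Definition branch (s : seq nat) (t : nat) : seq nat := [seq x <- s | ancestor x t].

Definition top_vars (s : seq nat) : seq nat :=
  [seq v <- s | (tok_at w v == TVar) && ~~ has (ancestor^~ v) s].

Definition branch_embeds (t e : nat) : bool :=
  embeds vars_sub (branch (positions w) t) (branch (positions w) e).

Definition token_criterion : bool :=
  all (has_var 0) (top_vars (positions w)) &&
  all (fun t => has (branch_embeds t)
                    [seq e <- positions w | node_tok (tok_at w e) && ancestor 0 e])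
      [seq t <- positions w | node_tok (tok_at w t) && ~~ ancestor 0 t].

End Positions.

Lemma decides_node F : computes F -> decides (fun w e => node_tok (tok_at w (F w e))).
Proof. by move=> cF; rewrite /node_tok; auto with computability. Qed.

Lemma computes_arg_end F : computes F -> computes (fun w e => arg_end w (F w e)).
Proof. by move=> cF; rewrite /arg_end /tok_count /leaf_tok /=; auto 20 with computability. Qed.

#[local] Hint Resolve decides_node computes_arg_end : computability.

Lemma decides_ancestor F G :
  computes F -> computes G -> decides (fun w e => ancestor w (F w e) (G w e)).
Proof. by move=> cF cG; rewrite /ancestor; auto with computability. Qed.

#[local] Hint Resolve decides_ancestor : computability.

Lemma tok_at_minn w x : tok_at w (minn x (size w)) = tok_at w x.
Proof. by case: (leqP x (size w)) => // lt_wx; rewrite /tok_at !nth_default // ltnW. Qed.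

Lemma decides_same_name F G :
  computes F -> computes G -> decides (fun w e => same_name w (F w e) (G w e)).
Proof.
move=> cF cG; rewrite /same_name.
pose tok_plus w x y := tok_at w (minn (x + y) (size w)).
have tok_plusE w x y : tok_at w (x + y) = tok_plus w x y by rewrite /tok_plus tok_at_minn.
apply: (@eq_decides (fun w e => all (fun k =>
  has (fun j => (j < k) && (tok_plus w (F w e) j == TEnd)) (positions w) ||
      (tok_plus w (F w e) k == tok_plus w (G w e) k)) (positions w))).
  move=> w e _ _; apply: eq_all => k; rewrite !tok_plusE; congr (_ || _).
  by apply: eq_has => j; rewrite tok_plusE.
by rewrite /tok_plus; auto 20 using computes_addn with computability.
Qed.

#[local] Hint Resolve decides_same_name : computability.

Lemma decides_has_var F G :
  computes F -> computes G -> decides (fun w e => has_var w (F w e) (G w e)).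
Proof. by move=> cF cG; rewrite /has_var /own_vars; auto 20 with computability. Qed.

#[local] Hint Resolve decides_has_var : computability.

Lemma decides_vars_sub F G :
  computes F -> computes G -> decides (fun w e => vars_sub w (F w e) (G w e)).
Proof. by move=> cF cG; rewrite /vars_sub /own_vars; auto 20 with computability. Qed.

#[local] Hint Resolve decides_vars_sub : computability.

Lemma find_drop_iota (A : pred nat) n a : a <= n ->
  a + find A (drop a (iota 0 n)) = find (fun x => (a <= x) && A x) (iota 0 n).
Proof.
move=> lean; rewrite drop_iota -{2}(subnKC lean) iotaD find_cat !add0n size_iota.
rewrite ifF; last first.
  apply/negbTE/hasPn => x; rewrite mem_iota add0n => /andP[_ ltxa].
  by rewrite leqNgt ltxa.
by congr (_ + _); apply: eq_in_find => x; rewrite mem_iota => /andP[-> _].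
Qed.

Section GreedyPositions.
Variables (n : nat) (fits : rel nat) (A B : pred nat).

Definition greedy_step (b a : nat) : nat :=
  if A a then find (fun x => (b <= x) && (B x && fits a x)) (iota 0 n) else b.

Lemma greedy_step_leq b a : b <= n -> greedy_step b a <= n.
Proof.
by rewrite /greedy_step; case: ifP => // _ _; rewrite -[leqRHS](size_iota 0) find_size.
Qed.

Lemma embeds_filter_iota :
  embeds fits (filter A (iota 0 n)) (filter B (iota 0 n)) =
  has (fun x => (foldl greedy_step 0 (iota 0 n) <= x) && B x) (iota 0 n).
Proof.
pose suffix b := filter B (drop b (iota 0 n)).
have suffix_skip b a : b <= n -> A a -> skip_to fits (suffix b) a = suffix (greedy_step b a).
  move=> lebn Aa; rewrite /greedy_step Aa /suffix skip_to_filter drop_drop addnC.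
  by rewrite find_drop_iota.
have suffix_step s b : b <= n ->
    foldl (skip_to fits) (suffix b) (filter A s) = suffix (foldl greedy_step b s) /\
    foldl greedy_step b s <= n.
  elim: s b => //= a s IHs b lebn; case: ifP => Aa; last first.
    have -> : greedy_step b a = b by rewrite /greedy_step Aa.
    exact: IHs.
  by rewrite /= suffix_skip //; exact/IHs/greedy_step_leq.
rewrite /embeds -{1}[iota 0 n]drop0; have [-> len] := suffix_step (iota 0 n) 0 (leq0n n).
set b := foldl _ _ _ in len *.
rewrite /nilp size_filter -lt0n -has_count drop_iota -{2}(subnKC len) iotaD has_cat !add0n.
rewrite [X in X || _]negbTE; last first.
  by apply/hasPn => x; rewrite mem_iota add0n => /andP[_ ltxb]; rewrite leqNgt ltxb.
by apply: eq_in_has => x; rewrite mem_iota => /andP[-> _].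
Qed.

End GreedyPositions.

Lemma decides_branch_embeds F G :
  computes F -> computes G -> decides (fun w e => branch_embeds w (F w e) (G w e)).
Proof.
move=> cF cG; pose step w e :=
  greedy_step (size w) (vars_sub w)
    (fun x => ancestor w x (F w e)) (fun x => ancestor w x (G w e)).
have cfold : computes (fun w e => foldl (step w e) 0 (positions w)).
  apply: computes_foldl computes_zero _; rewrite /step /greedy_step.
  by apply: computes_if; auto with computability.
apply: (@eq_decides (fun w e => has (fun x =>
    (foldl (step w e) 0 (positions w) <= x) && ancestor w x (G w e)) (positions w))).
  by move=> w e _ _; rewrite /branch_embeds embeds_filter_iota.
by auto with computability.
Qed.

#[local] Hint Resolve decides_branch_embeds : computability.

Lemma decides_token_criterion : decides (fun w _ => token_criterion w).
Proof. by rewrite /token_criterion /top_vars; auto 20 with computability. Qed.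

(** * Occurrences of subformulas *)

Definition name_tok (t : tok) : bool := [|| t == TB0, t == TB1 | t == TEnd].

Fixpoint name_val (s : seq tok) : nat :=
  match s with
  | TB0 :: s' => (name_val s').*2
  | TB1 :: s' => (name_val s').*2.+1
  | _ => 0
  end.

Lemma nat_bitsK m r : name_val (nat_bits m ++ TEnd :: r) = m.
Proof.
rewrite /nat_bits; case E: (N.of_nat m) => [|x] /=; first by lia.
have -> : m = Pos.to_nat x by lia.
by elim: x {E} => [x IHx|x IHx|] //=; rewrite IHx; lia.
Qed.

Lemma size_enc_f_gt0 g : 0 < size (enc_f g).
Proof. by case: g. Qed.

Lemma nth_enc_var m j : 0 < j < size (enc_f (Var m)) ->
  nth TTop (enc_f (Var m)) j = if j == (size (enc_f (Var m))).-1 then TEnd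
                               else nth TTop (nat_bits m) j.-1.
Proof.
case: j => // j; rewrite /= size_cat addn1 eqSS nth_cat !ltnS.
by case: ltngtP => // ->; rewrite subnn.
Qed.

Lemma name_tok_enc_var m j : 0 < j < size (enc_f (Var m)) ->
  name_tok (nth TTop (enc_f (Var m)) j).
Proof.
move=> lt_j; rewrite nth_enc_var //; case: eqP => // neq_j.
have /allP := @all_nat_bits name_tok m isT isT; apply; apply: mem_nth.
by move: lt_j neq_j; rewrite /= size_cat /=; lia.
Qed.

Lemma enc_var_end m j : j < size (enc_f (Var m)) ->
  (nth TTop (enc_f (Var m)) j == TEnd) = (j == (size (enc_f (Var m))).-1).
Proof.
case: j => [|j] lt_j; first by rewrite /= size_cat addn1.
rewrite nth_enc_var //; case: (j.+1 =P _) => // neq_j; apply/negbTE.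
have /allP := @all_nat_bits (predC1 TEnd) m isT isT; apply; apply: mem_nth.
by move: lt_j neq_j; rewrite /= size_cat /=; lia.
Qed.

Lemma count_nat_bits (a : pred tok) m : ~~ a TB0 -> ~~ a TB1 -> count a (nat_bits m) = 0.
Proof.
move=> a0 a1; apply/eqP; rewrite eqn0Ngt -has_count -all_predC.
exact: (all_nat_bits (a := predC a)).
Qed.

Lemma count_leaf_enc_f g : count leaf_tok (enc_f g) = (count (pred1 TAnd) (enc_f g)).+1.
Proof.
elim: g => [m||a IHa b IHb|a IHa] //=.
  by rewrite !count_cat !count_nat_bits.
by rewrite !count_cat IHa IHb add0n add1n addSn addnS.
Qed.

Lemma count_leaf_take_enc_f g j : j < size (enc_f g) ->
  count leaf_tok (take j (enc_f g)) <= count (pred1 TAnd) (take j (enc_f g)).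
Proof.
elim: g j => [m||a IHa b IHb|a IHa] [|j] //=; rewrite ?size_cat ?ltnS //; last exact: IHa.
  rewrite addn1 ltnS => le_j; rewrite takel_cat //.
  have := count_nat_bits (a := leaf_tok) m isT isT.
  rewrite -{1}(cat_take_drop j (nat_bits m)) count_cat => /eqP.
  by rewrite addn_eq0 => /andP[/eqP->].
move=> lt_j; rewrite take_cat add1n add0n; case: ltnP => [/IHa|le_j]; first exact: leqW.
by rewrite !count_cat count_leaf_enc_f addSn ltnS leq_add2l IHb //; lia.
Qed.

Lemma leaves_outnumber_ands g j : j <= size (enc_f g) ->
  (count (pred1 TAnd) (take j (enc_f g)) < count leaf_tok (take j (enc_f g))) =
  (j == size (enc_f g)).
Proof.
rewrite leq_eqVlt => /predU1P[->|lt_j]; first by rewrite take_size count_leaf_enc_f ltnSn eqxx.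
by rewrite ltnNge count_leaf_take_enc_f // ltn_eqF.
Qed.

Lemma prefix_cat (T : eqType) (s1 s2 s : seq T) :
  prefix (s1 ++ s2) s = prefix s1 s && prefix s2 (drop (size s1) s).
Proof.
elim: s1 s => [|x s1 IHs1] s; first by rewrite drop0 prefix0s.
by case: s => //= y s; rewrite IHs1 andbA.
Qed.

Lemma filter_nil (T : eqType) (a : pred T) s : {in s, forall x, ~~ a x} -> filter a s = [::].
Proof. by move=> /hasPn; rewrite has_filter negbK => /eqP. Qed.

Lemma filter_iota_range (a : pred nat) n i k : i + k <= n ->
  (forall x, a x -> i <= x < i + k) -> filter a (iota 0 n) = filter a (iota i k).
Proof.
move=> le_ikn a_ik; have -> : n = i + (k + (n - i - k)) by lia.
rewrite !iotaD !filter_cat add0n.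
by rewrite (@filter_nil _ a (iota 0 i)) ?(@filter_nil _ a (iota (i + k) _)) ?cats0 // => x;
  rewrite mem_iota => x_in; apply/negP => /a_ik; lia.
Qed.

Section Occurrences.
Variable w : seq tok.
Notation n := (size w).

Definition occurs (g : spf) (o : nat) : bool := prefix (enc_f g) (drop o w).

Definition block (g : spf) (o : nat) : seq nat := iota o (size (enc_f g)).

Lemma occurs_and a b o : occurs (And a b) o ->
  occurs a o.+1 /\ occurs b (o.+1 + size (enc_f a)).
Proof.
rewrite /occurs -[enc_f _]/([:: TAnd] ++ (enc_f a ++ enc_f b)) prefix_cat drop_drop add1n.
by rewrite prefix_cat drop_drop addnC => /and3P[_ -> ->].
Qed.

Lemma occurs_dia a o : occurs (Dia a) o -> occurs a o.+1.
Proof.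
by rewrite /occurs -[enc_f _]/([:: TDia] ++ enc_f a) prefix_cat drop_drop add1n => /andP[].
Qed.

Lemma occurs_leq g o : occurs g o -> o + size (enc_f g) <= n.
Proof.
case/prefixP=> r drop_w; have := size_drop o w; rewrite drop_w size_cat.
by have := size_enc_f_gt0 g; lia.
Qed.

Lemma occurs_tok g o j : occurs g o -> j < size (enc_f g) ->
  tok_at w (o + j) = nth TTop (enc_f g) j.
Proof. by case/prefixP=> r drop_w lt_j; rewrite /tok_at -nth_drop drop_w nth_cat lt_j. Qed.

Lemma occurs_from_toks g o : o + size (enc_f g) <= n ->
  (forall j, j < size (enc_f g) -> tok_at w (o + j) = nth TTop (enc_f g) j) -> occurs g o.
Proof.
move=> le_n toks.
have le_drop : size (enc_f g) <= size (drop o w) by rewrite size_drop; lia.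
rewrite /occurs prefixE; apply/eqP/(@eq_from_nth _ TTop); rewrite size_takel // => j lt_j.
by rewrite nth_take // nth_drop; exact: toks.
Qed.

Lemma occurs_head g o : occurs g o -> tok_at w o = head TTop (enc_f g).
Proof. by move=> occ; rewrite -[o]addn0 (occurs_tok occ) ?nth0 ?size_enc_f_gt0. Qed.

Lemma occurs_tok_sub g o x : occurs g o -> o <= x < o + size (enc_f g) ->
  tok_at w x = nth TTop (enc_f g) (x - o).
Proof. by move=> occ x_in; rewrite -(occurs_tok occ) ?subnKC //; lia. Qed.

Lemma subformula_at g o x : occurs g o -> o <= x < o + size (enc_f g) ->
  ~~ name_tok (tok_at w x) ->
  exists2 h, occurs h x & x + size (enc_f h) <= o + size (enc_f g).
Proof.
elim: g o => [m||a IHa b IHb|a IHa] o occ x_in;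
  (have [->|neq_xo] := eqVneq x o; first by eexists; first exact: occ).
- by rewrite (occurs_tok_sub occ x_in) name_tok_enc_var //; lia.
- by move: x_in => /=; lia.
- have [occ_a occ_b] := occurs_and occ; move: x_in; rewrite /= size_cat => x_in.
  case: (ltnP x (o.+1 + size (enc_f a))) => lt_x tok_x.
    by have [|h occ_h le_h] := IHa _ occ_a _ tok_x; [lia|exists h => //; lia].
  by have [|h occ_h le_h] := IHb _ occ_b _ tok_x; [lia|exists h => //; lia].
- move: x_in => /= x_in tok_x.
  by have [|h occ_h le_h] := IHa _ (occurs_dia occ) _ tok_x; [lia|exists h => //; lia].
Qed.

Lemma node_arg g o x : occurs g o -> o <= x < o + size (enc_f g) -> node_tok (tok_at w x) ->
  exists2 a, occurs a x.+1 & x + size (enc_f a) < o + size (enc_f g).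
Proof.
move=> occ x_in node_x; have [|h occ_h le_h] := subformula_at occ x_in.
  by case/orP: node_x => /eqP ->.
move: node_x; rewrite (occurs_head occ_h).
case: h occ_h le_h => // a /occurs_dia occ_a le_a _.
by exists a => //; move: le_a => /=; lia.
Qed.

Lemma var_at g o x : occurs g o -> o <= x < o + size (enc_f g) -> tok_at w x == TVar ->
  exists m, occurs (Var m) x.
Proof.
move=> occ x_in /eqP tok_x; have [|h occ_h _] := subformula_at occ x_in.
  by rewrite tok_x.
by move: tok_x; rewrite (occurs_head occ_h); case: h occ_h => // m; exists m.
Qed.

Lemma tok_count_occurs g x j (a : pred tok) : occurs g x.+1 -> j <= size (enc_f g) ->
  tok_count w a x (x + j) = count a (take j (enc_f g)).
Proof.
move=> occ le_j; have le_n := occurs_leq occ; rewrite /tok_count -size_filter.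
rewrite (@filter_iota_range _ n x.+1 j); [|by lia|by move=> y /andP[]; lia].
rewrite size_filter -[take _ _](@map_nth_iota0 _ TTop) // count_map.
rewrite -[X in iota X _]addn0 iotaDl count_map.
apply: eq_in_count => y; rewrite mem_iota => lt_yj /=.
have -> : (x < x.+1 + y) && (x.+1 + y <= x + j) by lia.
by rewrite (occurs_tok occ) //; lia.
Qed.

Lemma arg_end_occurs g x : occurs g x.+1 -> arg_end w x = x + size (enc_f g).
Proof.
move=> occ; have le_n := occurs_leq occ; set k := size _ in le_n *.
have outnumber j : j <= k ->
    (tok_count w (pred1 TAnd) x (x + j) < tok_count w leaf_tok x (x + j)) = (j == k).
  by move=> le_j; rewrite !(tok_count_occurs _ occ) // leaves_outnumber_ands.
have size_w : n = x + k + (n - (x + k)).-1.+1 by lia.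
rewrite /arg_end /positions {1}size_w iotaD find_cat add0n ifF; last first.
  apply/negbTE/hasPn => z; rewrite mem_iota => /andP[_ lt_z].
  case: (leqP x z) => [le_xz|lt_zx]; first by rewrite -(subnKC le_xz) outnumber; lia.
  have count0 a : tok_count w a x z = 0.
    apply/eqP; rewrite eqn0Ngt -has_count; apply/hasPn => y _.
    by apply/negP => /andP[/andP[lt_xy le_yz] _]; lia.
  by rewrite !count0.
by rewrite /= outnumber // eqxx size_iota addn0.
Qed.

Definition node_of (x : nat) (g : spf) : bool := node_tok (tok_at w x) && occurs g x.+1.

Lemma ancestor_node x g y : node_of x g -> ancestor w x y = (x <= y <= x + size (enc_f g)).
Proof. by case/andP=> node_x /arg_end_occurs arg_x; rewrite /ancestor node_x arg_x. Qed.

Lemma ancestor_block g o x y : occurs g o -> x \in block g o -> ancestor w x y ->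
  x <= y < o + size (enc_f g).
Proof.
rewrite mem_iota => occ x_in anc_xy; have /andP[node_x _] := anc_xy.
have [a occ_a lt_a] := node_arg occ x_in node_x.
by move: anc_xy; rewrite (@ancestor_node x a) /node_of ?node_x //; lia.
Qed.

Lemma ancestor_leq x y : ancestor w x y -> x <= y.
Proof. by case/and3P. Qed.

Definition name (v : nat) : nat := name_val (drop v.+1 w).

Lemma name_occurs m v : occurs (Var m) v -> name v = m.
Proof.
case/prefixP=> r drop_w; rewrite /name -add1n -drop_drop drop_w /= drop0 -catA.
exact: nat_bitsK.
Qed.

Definition names (x : nat) : seq nat := [seq name v | v <- own_vars w x].

Definition words (r s : seq nat) : seq (seq (seq nat)) :=
  [seq [seq names x | x <- branch w r t] | t <- s & node_tok (tok_at w t)].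

Definition unrelated (s1 s2 : seq nat) : Prop :=
  {in s1 & s2, forall x y, ~~ ancestor w x y && ~~ ancestor w y x}.

Lemma top_vars_cat s1 s2 : unrelated s1 s2 ->
  top_vars w (s1 ++ s2) = top_vars w s1 ++ top_vars w s2.
Proof.
move=> unrel; rewrite /top_vars filter_cat; congr (_ ++ _); apply: eq_in_filter => v v_in;
  rewrite has_cat negb_or; congr (_ && _).
  rewrite (_ : ~~ has _ s2) ?andbT //; apply/hasPn => x x_in.
  by have /andP[] := unrel v x v_in x_in.
rewrite (_ : ~~ has _ s1) //; apply/hasPn => x x_in.
by have /andP[] := unrel x v x_in v_in.
Qed.

Lemma words_catl s1 s2 : unrelated s1 s2 -> words (s1 ++ s2) s1 = words s1 s1.
Proof.
move=> unrel; apply/eq_in_map => t; rewrite mem_filter => /andP[_ t_in].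
rewrite /branch filter_cat [filter _ s2]filter_nil ?cats0 // => x x_in.
by have /andP[] := unrel t x t_in x_in.
Qed.

Lemma words_catr s1 s2 : unrelated s1 s2 -> words (s1 ++ s2) s2 = words s2 s2.
Proof.
move=> unrel; apply/eq_in_map => t; rewrite mem_filter => /andP[_ t_in].
rewrite /branch filter_cat [filter _ s1]filter_nil // => x x_in.
by have /andP[] := unrel x t x_in t_in.
Qed.

Lemma words_cat r s1 s2 : words r (s1 ++ s2) = words r s1 ++ words r s2.
Proof. by rewrite /words filter_cat map_cat. Qed.

Lemma top_vars_cons x s : ~~ node_tok (tok_at w x) -> tok_at w x != TVar ->
  top_vars w (x :: s) = top_vars w s.
Proof.
move=> /negbTE not_node /negbTE not_var; rewrite /top_vars /= not_var /=.
by apply: eq_filter => v; rewrite /ancestor not_node.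
Qed.

Lemma words_cons x s : ~~ node_tok (tok_at w x) -> words (x :: s) (x :: s) = words s s.
Proof.
move=> /negbTE not_node; rewrite /words /= not_node; apply: eq_map => t.
by rewrite /branch /= /ancestor not_node.
Qed.

Lemma unrelated_blocks a b o : occurs a o ->
  unrelated (block a o) (block b (o + size (enc_f a))).
Proof.
move=> occ_a x y x_in; rewrite mem_iota => /andP[le_y _].
have x_lt : x < o + size (enc_f a) by move: x_in; rewrite mem_iota => /andP[].
apply/andP; split; apply/negP => anc.
  by have := ancestor_block occ_a x_in anc; lia.
by have := ancestor_leq anc; lia.
Qed.

Lemma block_and a b o :
  block (And a b) o = o :: block a o.+1 ++ block b (o.+1 + size (enc_f a)).
Proof. by rewrite /block /= size_cat iotaD. Qed.

Lemma top_vars_node x g : node_of x g -> top_vars w (x :: block g x.+1) = [::].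
Proof.
move=> node_x; apply: filter_nil => v v_in.
rewrite negb_and negbK; apply/orP; right; apply/hasP; exists x; first exact: mem_head.
by rewrite (ancestor_node _ node_x); move: v_in; rewrite inE mem_iota; lia.
Qed.

Lemma var_block_tok m o x : occurs (Var m) o -> x \in iota o.+1 (size (enc_f (Var m))).-1 ->
  name_tok (tok_at w x).
Proof.
move=> occ; rewrite mem_iota => x_in.
by rewrite (occurs_tok_sub occ) ?name_tok_enc_var //; lia.
Qed.

Lemma block_var m o : block (Var m) o = o :: iota o.+1 (size (enc_f (Var m))).-1.
Proof. by []. Qed.

Lemma map_name_top_vars g o : occurs g o -> map name (top_vars w (block g o)) = vars g.
Proof.
elim: g o => [m||a IHa b IHb|a IHa] o occ; have tok_o := occurs_head occ.
- have not_node_var := var_block_tok occ.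
  rewrite block_var -cat1s top_vars_cat => [|x y]; last first.
    rewrite inE => /eqP-> /not_node_var; rewrite /ancestor tok_o.
    by case: tok_at.
  rewrite [top_vars w (iota _ _)]filter_nil => [|x /not_node_var]; last by case: tok_at.
  by rewrite /top_vars /= /ancestor tok_o /= (name_occurs occ).
- by rewrite /top_vars /= tok_o.
- have [occ_a occ_b] := occurs_and occ.
  rewrite block_and top_vars_cons ?tok_o // top_vars_cat ?map_cat ?IHa ?IHb //.
  exact: unrelated_blocks.
- by rewrite [block _ _]/= top_vars_node // /node_of tok_o occurs_dia.
Qed.

Lemma own_vars_node x g : node_of x g -> own_vars w x = top_vars w (block g x.+1).
Proof.
move=> node_x; have [node_tok_x occ] := andP node_x.
have le_n := occurs_leq occ; rewrite /own_vars /top_vars /positions.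
rewrite (@filter_iota_range _ n x.+1 (size (enc_f g))) //; last first.
  move=> v /and3P[/eqP tok_v]; rewrite (ancestor_node _ node_x) => v_in _.
  suff: v != x by lia.
  by apply/eqP => eq_vx; move: node_tok_x; rewrite -eq_vx tok_v.
apply: eq_in_filter => v; rewrite mem_iota => v_in; congr (_ && _).
rewrite (ancestor_node _ node_x) (_ : x <= v <= _); last by lia.
congr (~~ _); apply/hasP/hasP => -[z z_in].
  move=> /andP[lt_xz anc_z]; exists z => //; have := ancestor_leq anc_z.
  by rewrite mem_iota; lia.
move: z_in; rewrite mem_iota => z_in anc_z; exists z; first by rewrite mem_iota; lia.
by rewrite anc_z andbT; lia.
Qed.

Lemma names_node x g : node_of x g -> names x = vars g.
Proof.
move=> node_x; have [_ occ] := andP node_x.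
by rewrite /names (own_vars_node node_x) map_name_top_vars.
Qed.

Lemma words_node x g : node_of x g -> words (block g x.+1) (block g x.+1) = branches g ->
  words (x :: block g x.+1) (x :: block g x.+1) = branches (Dia g).
Proof.
move=> node_x words_g; have [node_tok_x occ] := andP node_x.
rewrite /words /= node_tok_x /= -words_g /words -map_comp.
rewrite (ancestor_node _ node_x) leqnn leq_addr /= (names_node node_x).
congr ((_ :: _) :: _).
  rewrite [branch _ _ _]filter_nil // => y; rewrite mem_iota => y_in.
  by apply/negP => /ancestor_leq; lia.
apply/eq_in_map => t; rewrite mem_filter mem_iota => /andP[_ t_in] /=.
by rewrite (ancestor_node _ node_x) (_ : x <= t <= _) /= ?(names_node node_x) //; lia.
Qed.

Lemma words_block g o : occurs g o -> words (block g o) (block g o) = branches g.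
Proof.
elim: g o => [m||a IHa b IHb|a IHa] o occ; have tok_o := occurs_head occ.
- rewrite /words filter_nil // => x; rewrite block_var inE.
  by case/predU1P=> [->|/(var_block_tok occ)]; [rewrite tok_o|case: tok_at].
- by rewrite /words /= tok_o.
- have [occ_a occ_b] := occurs_and occ.
  have unrel := @unrelated_blocks a b o.+1 occ_a.
  by rewrite block_and words_cons ?tok_o // words_cat words_catl // words_catr // IHa // IHb.
- have occ_a := occurs_dia occ.
  by apply: words_node (IHa _ occ_a); rewrite /node_of tok_o occ_a.
Qed.

Lemma same_name_occurs m m' v v' :
  occurs (Var m) v -> occurs (Var m') v' -> same_name w v v' = (m == m').
Proof.
move=> occ occ'; set L := size (enc_f (Var m)).
have le_n := occurs_leq occ; have L_gt0 : 0 < L := size_enc_f_gt0 _.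
apply/allP/eqP => [same|eq_m k _]; last first.
  subst m'; case: (ltnP k L) => [lt_k|le_L].
    by rewrite (occurs_tok occ) // (occurs_tok occ') // eqxx orbT.
  apply/orP; left; apply/hasP; exists L.-1; first by rewrite mem_iota; lia.
  by rewrite (occurs_tok occ) ?enc_var_end ?eqxx ?andbT -/L; lia.
suff occ_v' : occurs (Var m) v' by rewrite -(name_occurs occ_v') (name_occurs occ').
have tok_v' k : k < L -> tok_at w (v' + k) = nth TTop (enc_f (Var m)) k.
  move=> lt_k; have k_in : k \in positions w by rewrite mem_iota; lia.
  have := same k k_in; rewrite -(occurs_tok occ) // => /orP[/hasP[j _ /andP[lt_j]]|/eqP-> //].
  by rewrite (occurs_tok occ) ?enc_var_end -/L; lia.
apply: (occurs_from_toks _ tok_v'); rewrite -/L leqNgt; apply/negP => lt_n.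
have := @enc_var_end m L.-1; rewrite -/L eqxx -tok_v' ?prednK // => /(_ (leqnn _)).
by rewrite /tok_at nth_default //; lia.
Qed.

Hypothesis varsP : forall v, tok_at w v == TVar -> exists m, occurs (Var m) v.

Lemma own_vars_occurs x v : v \in own_vars w x -> exists m, occurs (Var m) v.
Proof. by rewrite mem_filter => /andP[/andP[/varsP]]. Qed.

Lemma has_var_names x v : tok_at w v == TVar -> has_var w x v = (name v \in names x).
Proof.
case/varsP=> m occ; rewrite (name_occurs occ); apply/hasP/mapP => -[v' v'_in].
  have [m' occ'] := own_vars_occurs v'_in.
  by rewrite (same_name_occurs occ occ') => /eqP->; exists v'; rewrite ?(name_occurs occ').
have [m' occ'] := own_vars_occurs v'_in.
by rewrite (name_occurs occ') => eq_m; exists v'; rewrite ?(same_name_occurs occ occ') ?eq_m.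
Qed.

Lemma vars_sub_names x x' : vars_sub w x x' = sub_vars (names x) (names x').
Proof.
rewrite /sub_vars all_map; apply: eq_in_all => v.
by rewrite mem_filter => /andP[/andP[tok_v _] _]; exact: has_var_names.
Qed.

Lemma branch_embeds_names t e : branch_embeds w t e =
  embeds sub_vars [seq names x | x <- branch w (positions w) t]
                  [seq names x | x <- branch w (positions w) e].
Proof.
by rewrite (embeds_map (fits' := vars_sub w)) // => x y; rewrite vars_sub_names.
Qed.

End Occurrences.

Section Criterion.
Variables s t : spf.
Let w := enc (Imp s t).
Let ante_positions : seq nat := 0 :: block s 1.
Let cons_positions : seq nat := block t (1 + size (enc_f s)).

Lemma positions_enc : positions w = ante_positions ++ cons_positions.
Proof. by rewrite /positions /w /= size_cat iotaD. Qed.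

Lemma occurs_ante : occurs w s 1.
Proof. by rewrite /occurs /w /= drop0 prefix_prefix. Qed.

Lemma occurs_cons : occurs w t (1 + size (enc_f s)).
Proof. by rewrite /occurs /w /= drop_size_cat // prefix_refl. Qed.

Lemma node_of_root : node_of w 0 s.
Proof. by rewrite /node_of occurs_ante. Qed.

Lemma unrelated_ante_cons : unrelated w ante_positions cons_positions.
Proof.
move=> x y; rewrite inE => /predU1P[->|]; last first.
  exact: (@unrelated_blocks w s t 1 occurs_ante x y).
rewrite mem_iota => /andP[lt_sy _]; rewrite (ancestor_node _ node_of_root).
by apply/andP; split; [|apply/negP => /ancestor_leq]; lia.
Qed.

Lemma ancestor_root_ante x : x \in ante_positions -> ancestor w 0 x.
Proof. by rewrite (ancestor_node _ node_of_root) inE mem_iota; lia. Qed.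

Lemma ancestor_root_cons x : x \in cons_positions -> ~~ ancestor w 0 x.
Proof. by move=> x_in; have /andP[] := unrelated_ante_cons (mem_head _ _) x_in. Qed.

Lemma filter_ante_positions (a : pred nat) :
  [seq x <- positions w | a x && ancestor w 0 x] = [seq x <- ante_positions | a x].
Proof.
rewrite positions_enc filter_cat [filter _ cons_positions]filter_nil ?cats0 =>
  [|x /ancestor_root_cons].
  by apply: eq_in_filter => x /ancestor_root_ante ->; rewrite andbT.
by rewrite negb_and orbC => ->.
Qed.

Lemma filter_cons_positions (a : pred nat) :
  [seq x <- positions w | a x && ~~ ancestor w 0 x] = [seq x <- cons_positions | a x].
Proof.
rewrite positions_enc filter_cat [filter _ ante_positions]filter_nil =>
  [|x /ancestor_root_ante ->].
  by apply: eq_in_filter => x /ancestor_root_cons ->; rewrite andbT.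
by rewrite andbF.
Qed.

Lemma var_positions v : tok_at w v == TVar -> exists m, occurs w (Var m) v.
Proof.
move=> tok_v; have : v \in positions w.
  by rewrite mem_iota ltnNge; apply: contraL tok_v => le_n; rewrite /tok_at nth_default.
rewrite positions_enc mem_cat inE !mem_iota => /orP[/predU1P[v0|v_in]|v_in].
- by rewrite v0 in tok_v.
- exact: var_at occurs_ante v_in tok_v.
- exact: var_at occurs_cons v_in tok_v.
Qed.

Lemma token_criterion_enc : token_criterion w = lin_criterion (Imp s t).
Proof.
have unrel := unrelated_ante_cons.
have top_vars_t : map (name w) (top_vars w (positions w)) = vars t.
  rewrite positions_enc top_vars_cat // (top_vars_node node_of_root).
  exact: map_name_top_vars occurs_cons.
have words_s : words w (positions w) ante_positions = branches (Dia s).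
  rewrite positions_enc words_catl // (words_node node_of_root) //.
  by rewrite words_block // occurs_ante.
have words_t : words w (positions w) cons_positions = branches t.
  by rewrite positions_enc words_catr // words_block // occurs_cons.
rewrite /token_criterion /lin_criterion -words_s -words_t -top_vars_t.
rewrite -(names_node node_of_root).
congr (_ && _).
  rewrite /sub_vars all_map; apply: eq_in_all => v.
  rewrite mem_filter => /andP[/andP[tok_v _] _].
  exact: has_var_names var_positions _ _ tok_v.
rewrite filter_ante_positions filter_cons_positions /words all_map; apply: eq_all => x.
rewrite [RHS]has_map; apply: eq_has => y.
exact: branch_embeds_names var_positions x y.
Qed.

End Criterion.

Theorem theorem7p13 : poly_time_decidable SPi_lin.
Proof.
apply: poly_time_decidable_input decides_token_criterion _ => -[s t].
by rewrite token_criterion_enc SPi_linP.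
Qed.
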